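(* Let $1\leq k\leq d$ be integers, and let $\mathcal{B}_N^{k,d}$ be the set of all balanced $(d-1)$-dimensional complexes $\Delta$ with $f_{k-1}(\Delta) = N>0$. If $N$ has the $(k,d)$-canonical representation \[N = \binom{N_{d}}{k}_{\!d} + \binom{N_{d-1}}{k-1}_{\!d-1} + \dots + \binom{N_{d-s}}{k-s}_{\!d-s},\] then for every $\Delta \in \mathcal{B}_N^{k,d}$, \[\beta_{d-1}(\Delta) \leq \binom{N_{d}-d}{d}_{\!d} + \binom{N_{d-1}-(d-1)}{d-1}_{\!d-1} + \dots + \binom{N_{d-s} - (d-s)}{d-s}_{\!d-s}. \qquad (\ast)\] Furthermore, if $\Delta \in \mathcal{B}_N^{k,d}$ is a revlex balanced complex with respect to $\Pi_d$ that satisfies \[f_{d-1}(\Delta) = \binom{N_{d}}{d}_{\!d} + \binom{N_{d-1}}{d-1}_{\!d-1} + \dots + \binom{N_{d-s}}{d-s}_{\!d-s},\] then equality holds in $(\ast)$.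
   Context: Simplicial complexes are finite, non-empty, subset-closed families of finite subsets of a countable ground set $U$. A $d$-colored complex is a pair $(\Delta,\pi)$ with $\pi=(U_1,\dots,U_d)$ an ordered partition of $U$ such that $|F\cap U_i|\le1$ for every face $F$ and every $i$; it is balanced if moreover $\dim\Delta=d-1$, and a complex is called balanced if such a $\pi$ exists. $f_i(\Delta)$ is the number of $i$-dimensional faces. Fix a field $\Bbbk$; $\beta_k=\dim_\Bbbk\widetilde H_k(\,\cdot\,;\Bbbk)$. $\Pi_d=(\Pi_{d,1},\dots,\Pi_{d,d})$ is the ordered partition of the positive integers with $\Pi_{d,i}=\{m\in\mathbb{P}: m\equiv i \pmod d\}$, with ground set $\mathbb{P}$ ordered by the usual order. For $j\ge0$, $\binom{\Pi_d}{j}$ is the set of $j$-element subsets of $\mathbb{P}$ meeting each $\Pi_{d,i}$ in at most one element. For $A,B\in\binom{\Pi_d}{j}$, $A>_{r\ell}B$ iff $\max(A\setminus B)>\max(B\setminus A)$. A complex $\Delta$ on $\mathbb{P}$, $d$-colored w.r.t. $\Pi_d$, is revlex w.r.t. $\Pi_d$ if for every $j\in[d]$: whenever $F,F'\in\binom{\Pi_d}{j}$, $F>_{r\ell}F'$ and $F\in\Delta$, then $F'\in\Delta$. The Turán graph $T_d(n)$ is the complete $d$-partite graph on $n$ vertices with parts of sizes $\lfloor n/d\rfloor$ or $\lceil n/d\rceil$; $\binom{n}{k}_{\!d}$ is the number of $k$-cliques of $T_d(n)$ for $0\le k\le n$, and $0$ if $k>n$, $k<0$ or $n<0$. For positive integers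 $N,k,r$ with $r\ge k$ there are unique integers $s,N_k,\dots,N_{k-s}$ with $N=\sum_{i=0}^{s}\binom{N_{k-i}}{k-i}_{\!r-i}$, $N_{k-i}-\lfloor N_{k-i}/(r-i)\rfloor>N_{k-i-1}$ for $0\le i<s$, and $N_{k-s}\ge k-s>0$: the $(k,r)$-canonical representation. In the statement the integers are indexed by the lower subscript, i.e. the $i$-th term is $\binom{N_{d-i}}{k-i}_{\!d-i}$. *)

(* Defs.v *)
From mathcomp Require Import all_boot all_order all_algebra finmap.

Set Implicit Arguments.
Unset Strict Implicit.
Unset Printing Implicit Defensive.

Import Order.TTheory GRing.Theory Num.Theory.
Local Open Scope fset_scope.
Local Open Scope ring_scope.

Section Complexes.
Variable U : countType.
Implicit Types D : {fset {fset U}}.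

Definition simplicial_complex D : Prop :=
  D != fset0 /\ (forall A B : {fset U}, A `<=` B -> B \in D -> A \in D).

Definition dimension D : int := (\max_(A <- D) #|` A|)%N%:Z - 1.

(* Faces are selected by cardinality: [card_faces D j] holds the faces of
   dimension j - 1, and the empty face for j = 0. *)
Definition card_faces D (j : nat) : {fset {fset U}} :=
  [fset A in D | #|` A| == j].

Definition f_num D (i : nat) : nat := #|` card_faces D i.+1|.

(* The blocks U_1, ..., U_d are P 0, ..., P (d - 1).  Empty blocks are not
   excluded; in a balanced complex a face with d vertices meets every block. *)
Definition ordered_partition d (P : 'I_d -> pred U) : Prop :=
  forall u : U, exists! i : 'I_d, P i u.

Definition partial_transversal d (P : 'I_d -> pred U) (A : {fset U}) : Prop :=
  forall i : 'I_d, (#|` [fset x in A | P i x]| <= 1)%N.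

Definition colored d (P : 'I_d -> pred U) D : Prop :=
  [/\ simplicial_complex D, ordered_partition P
    & forall A : {fset U}, A \in D -> partial_transversal P A].

Definition balanced d D : Prop :=
  (exists P : 'I_d -> pred U, colored P D) /\ dimension D = d%:Z - 1.

(* The class B_N^{k,d}, for k >= 1. *)
Definition balanced_class (k d N : nat) D : Prop :=
  balanced d D /\ f_num D k.-1 = N.

Section Homology.
Variable K : fieldType.

(* Vertices are ordered by their code [pickle]; the coefficient of B minus x in
   the boundary of B is (-1)^p, with p the number of vertices of B before x. *)
Definition incidence (B A : {fset U}) : K :=
  \sum_(x <- B | A == B `\ x)
    (-1) ^+ #|` [fset y in B | (choice.pickle y < choice.pickle x)%N]|.

(* Matrix, acting on row vectors, of the boundary map from dimension i to
   dimension i - 1; for i = 0 this is the augmentation onto the empty face. *)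
Definition boundary D (i : nat) :
    'M[K]_(#|{: card_faces D i.+1}|, #|{: card_faces D i}|) :=
  \matrix_(b, a) incidence (val (enum_val b)) (val (enum_val a)).

(* (Z :\: B)%MS is a complement in the cycles of the boundaries, hence a model
   of the quotient Z / B. *)
Definition reduced_homology D (i : nat) :=
  (kermx (boundary D i) :\: boundary D i.+1)%MS.

Definition betti D (i : nat) : nat := \rank (reduced_homology D i).

End Homology.
End Complexes.

Notation posint := {n : nat | (0 < n)%N}.

Definition Pi_part (d : nat) : 'I_d -> pred posint :=
  fun i m => (val m == i.+1 %[mod d])%N.

(* An element of binom(Pi_d, j). *)
Definition Pi_subset (d j : nat) (A : {fset posint}) : Prop :=
  #|` A| = j /\ partial_transversal (@Pi_part d) A.

(* Equals 0 on the empty set; distinct sets of the same cardinality have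
   nonempty differences, so this value plays no role in [revlex_gt]. *)
Definition fset_max (A : {fset posint}) : nat := (\max_(x <- A) val x)%N.

Definition revlex_gt (A B : {fset posint}) : bool :=
  (fset_max (B `\` A) < fset_max (A `\` B))%N.

Definition revlex (d : nat) (D : {fset {fset posint}}) : Prop :=
  colored (@Pi_part d) D /\
  (forall (j : nat) (F F' : {fset posint}), (1 <= j <= d)%N ->
     Pi_subset d j F -> Pi_subset d j F' ->
     revlex_gt F F' -> F \in D -> F' \in D).

(* Vertex x lies in the part x mod d, so that each of the d parts has size
   floor(n/d) or ceil(n/d). *)
Definition turan_graph (d n : nat) : rel 'I_n :=
  fun x y => (x != y %[mod d])%N.

Definition cliques (T : finType) (e : rel T) (k : nat) : {set {set T}} :=
  [set A : {set T} | (#|A| == k) &&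
     [forall x in A, forall y in A, (x != y) ==> e x y]].

(* There are no k-cliques on n < k vertices, so this case needs no clause. *)
Definition turan_binom (n k : int) (d : nat) : nat :=
  match n, k with
  | Posz n, Posz k => #|cliques (@turan_graph d n) k|
  | _, _ => 0%N
  end.

(* The (k,d)-canonical representation of N, with the upper entry of the i-th
   term written M (d - i); only the values M (d - s), ..., M d matter.  All
   natural subtractions are exact, since i <= s < k <= d. *)
Definition canonical_representation (N k d s : nat) (M : nat -> int) : Prop :=
  [/\ N = (\sum_(i < s.+1) turan_binom (M (d - i)) (k - i)%N (d - i))%N,
      forall i : nat, (i < s)%N ->
        M (d - i.+1)%N < M (d - i)%N - (M (d - i)%N %/ (d - i)%N)%Z,
      (k - s)%N%:Z <= M (d - s)%N
    & (s < k)%N].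

(* Main.v *)
(** Let V_1, ..., V_d be the colour classes. A top cycle is a function on
    V_1 x ... x V_d that vanishes off the facets and sums to zero along each
    coordinate. For a vertex v of colour 1, restricting the cycles to v gives
    cycles of the link of v; let r_v be the dimension of the space of these
    restrictions, and let v_0 maximise r_v. As the restrictions add up to zero,
    the cycle space has dimension at most the sum of the r_v over v <> v_0. The
    faces with colour 1 are counted by the links, and those without it include
    the link of v_0, so induction on d bounds the number of (k-1)-faces from
    below by an expression in r_(v_0) and the other r_v.

    Let G(d,k,m) be the number of (k-1)-faces of the complex that revlex order
    assigns to m top cycles: the cross-polytopal complex on d colours, followed
    by its vertices one at a time. The combinatorial core is the inequality
    G(d,k,sum b_i) <= G(d-1,k,b) + G(d-1,k-1,b) + sum G(d-1,k-1,b_i) for b_i <= b,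
    which shows that m independent top cycles require G(d,k,m) faces. It is a
    numerical form of colour compression: the part of the b_i above the largest
    full layer below b is moved into a layer of its own.

    For the equality case, a facet F that avoids the first vertex of each colour
    spans with these d vertices a cross-polytope all of whose facets precede F
    in revlex order. The fundamental cycles of these cross-polytopes are
    independent, and such facets are counted by deleting the last vertex. *)
Require Import Defs.
From mathcomp Require Import all_boot all_order all_algebra finmap.
From mathcomp Require Import zify ring.

Set Implicit Arguments.
Unset Strict Implicit.
Unset Printing Implicit Defensive.

Import Order.TTheory GRing.Theory Num.Theory.
Local Open Scope fset_scope.
Local Open Scope ring_scope.
Local Open Scope nat_scope.

(** * Face numbers of Turan graphs *)

(** Cliques are sorted by their largest vertex [t]: the [t - t %/ d'.+1] smaller vertices outside
    the part of [t] induce a Turan graph with one part fewer. *)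
Fixpoint turan d n k : nat :=
  match k, d with
  | 0, _ => 1
  | _.+1, 0 => 0
  | k'.+1, d'.+1 => \sum_(t < n) turan d' (t - t %/ d'.+1) k'
  end.

Lemma turan_k0 d n : turan d n 0 = 1.
Proof. by case: d. Qed.

Lemma turanS d n k :
  turan d.+1 n.+1 k.+1 = turan d.+1 n k.+1 + turan d (n - n %/ d.+1) k.
Proof. by rewrite /= big_ord_recr. Qed.

Lemma leq_turan d k : {homo turan d ^~ k : m n / m <= n}.
Proof.
case: k => [|k] m n lemn; first by rewrite !turan_k0.
case: d => [|d] //; elim: n lemn => [|n IH]; first by rewrite leqn0 => /eqP->.
rewrite leq_eqVlt => /orP[/eqP-> //|]; rewrite ltnS => /IH le1.
by apply: leq_trans le1 _; rewrite turanS leq_addr.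
Qed.

Lemma subn_divn_homo d : {homo (fun n => n - n %/ d.+1) : m n / m <= n}.
Proof.
move=> m n; elim: n => [|n IH]; first by rewrite leqn0 => /eqP->.
rewrite leq_eqVlt => /orP[/eqP-> //|]; rewrite ltnS => /IH le1.
apply: leq_trans le1 _.
have := divn_eq n d.+1; have := divn_eq n.+1 d.+1.
have := ltn_mod n d.+1; have := ltn_mod n.+1 d.+1 => /=.
nia.
Qed.

Lemma turan_gt0 d n k : k <= d -> k <= n -> 0 < turan d n k.
Proof.
elim: d n k => [|d IH] n [|k] // kd; case: n => [|n] // kn.
rewrite turanS addn_gt0; apply/orP; right; apply: IH => //.
apply: leq_trans (subn_divn_homo d (_ : k <= n)); last by [].
by rewrite divn_small ?subn0.
Qed.

Lemma turan_small d n : n < d -> turan d n d = 0.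
Proof.
elim: d n => [|d IH] n // lt_nd; apply: big1 => -[t /= ltn] _.
by apply: IH; apply: leq_ltn_trans (leq_subr _ _) _; apply: leq_trans ltn _.
Qed.

(** By [layer_sizeE] this counts the [d]-cliques of T_d(d + j). The recursive form, one unit
    followed by successive layers, makes it an instance of [filled] below. *)
Fixpoint layer_size d j : nat :=
  if d is d'.+1 then 1 + \sum_(i < j) layer_size d' (i - i %/ d'.+1) else 1.

Lemma layer_sizeS d j :
  layer_size d.+1 j.+1 = layer_size d.+1 j + layer_size d (j - j %/ d.+1).
Proof. by rewrite /= big_ord_recr addnA. Qed.

Lemma layer_size_gt0 d j : 0 < layer_size d j.
Proof. by case: d. Qed.

Lemma leq_layer_size d : {homo layer_size d : i j / i <= j}.
Proof.
case: d => [|d] m n //; elim: n => [|n IH]; first by rewrite leqn0 => /eqP->.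
rewrite leq_eqVlt => /orP[/eqP-> //|]; rewrite ltnS => /IH le1.
by apply: leq_trans le1 _; rewrite layer_sizeS leq_addr.
Qed.

Lemma layer_sizeE d j : layer_size d j = turan d (d + j) d.
Proof.
elim: d j => [|d IH] j //.
elim: j => [|j IHj].
  rewrite addn0 turanS (turan_small (ltnSn d)) add0n divn_small // subn0.
  by have := IH 0; rewrite addn0 => <- /=; rewrite big_ord0 addn0;
    case: (d) => //= ?; rewrite big_ord0.
rewrite layer_sizeS addnS turanS IHj IH; congr (_ + turan _ _ _).
rewrite divnDl ?divnn //= add1n addSn subSS addnBA // leq_div //.
Qed.

(** A top clique takes one vertex from each part. A smallest part of T_(d+1)(d+1+j) has
    [1 + j %/ d.+1] vertices, and deleting it leaves T_d on [d + (j - j %/ d.+1)] vertices. *)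
Lemma layer_size_mul d j :
  layer_size d.+1 j = (1 + j %/ d.+1) * layer_size d (j - j %/ d.+1).
Proof.
elim: d j => [|d IHd]; elim=> [|j IHj].
- by rewrite /= big_ord0.
- by rewrite layer_sizeS IHj /= !divn1; lia.
- by rewrite /= !big_ord0.
rewrite layer_sizeS IHj.
set a := j %/ d.+2; have Ej := divn_eq j d.+2; rewrite -/a in Ej.
have Lc := ltn_mod j d.+2; rewrite /= in Lc.
case: (ltnP (j %% d.+2) d.+1) => Hc.
  have -> : j.+1 %/ d.+2 = a by rewrite {1}Ej -addnS divnMDl // divn_small ?addn0.
  have -> : j.+1 - a = (j - a).+1 by nia.
  rewrite layer_sizeS (IHd (j - a)).
  have -> : (j - a) %/ d.+1 = a.
    have -> : j - a = a * d.+1 + j %% d.+2 by nia.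
    by rewrite divnMDl // divn_small ?addn0.
  by set X := layer_size d _; ring.
have Ec : j %% d.+2 = d.+1 by lia.
have -> : j.+1 %/ d.+2 = a.+1.
  by rewrite (_ : j.+1 = a.+1 * d.+2) ?mulnK //; nia.
by rewrite subSS; set X := layer_size _ _; ring.
Qed.

(** * Filling layers in order: subadditivity and exchange *)

Section Filling.

Variables (cap g : nat -> nat) (c : nat).
Hypothesis cap_gt0 : forall j, 0 < cap j.
Hypothesis leq_cap : {homo cap : i j / i <= j}.

Definition filled j := 1 + \sum_(i < j) cap i.

(* By truncated subtraction, minn (m - filled j) (cap j) is the part of layer j
   in use when m units, one of which precedes layer 0, fill the layers in order. *)
Definition filling_cost m :=
  if m is 0 then 0 else c + \sum_(j < m) g (minn (m - filled j) (cap j)).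

Local Notation G := filling_cost.

Lemma filledS j : filled j.+1 = filled j + cap j.
Proof. by rewrite /filled big_ord_recr addnA. Qed.

Lemma leq_filled : {homo filled : i j / i <= j}.
Proof.
move=> i j; elim: j => [|j IH]; first by rewrite leqn0 => /eqP->.
rewrite leq_eqVlt => /orP[/eqP-> //|]; rewrite ltnS => /IH le1.
by apply: leq_trans le1 _; rewrite filledS leq_addr.
Qed.

Lemma ltn_filled j : j < filled j.
Proof. by elim: j => // j IH; rewrite filledS; have := cap_gt0 j; lia. Qed.

Lemma filled_level m : 0 < m ->
  exists j x, [/\ m = filled j + x & x < cap j].
Proof.
elim: m => // m IH _; case: (posnP m) => [->|m_gt0].
  by exists 0, 0; rewrite /filled big_ord0.
have [j [x [-> ltx]]] := IH m_gt0.
have [ltSx|geSx] := ltnP x.+1 (cap j); first by exists j, x.+1; rewrite addnS.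
exists j.+1, 0; rewrite filledS; split; last exact: cap_gt0.
by lia.
Qed.

Lemma filled_level_pos m : 1 < m ->
  exists j x, [/\ m = filled j + x, 0 < x & x <= cap j].
Proof.
case: m => // m m_gt0; have [j [x [-> ltx]]] := filled_level m_gt0.
by exists j, x.+1; rewrite addnS.
Qed.

Lemma leq_filling_cost :
  {homo g : a b / a <= b} -> {homo G : a b / a <= b}.
Proof.
move=> leq_g [|a] [|b] // leab; rewrite /G leq_add2l.
rewrite (big_ord_widen b.+1 (fun j => g (minn (a.+1 - filled j) (cap j)))) //.
rewrite big_mkcond leq_sum // => j _; case: ifP => // _.
by apply: leq_g; lia.
Qed.

Lemma filling_cost0 : G 0 = 0. Proof. by []. Qed.

Hypothesis g0 : g 0 = 0.

Lemma filling_costD j x : x <= cap j -> G (filled j + x) = G (filled j) + g x.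
Proof.
have aux y : y <= cap j -> G (filled j + y) = c + \sum_(i < j) g (cap i) + g y.
  move=> ley; rewrite {1}/G.
  case E: (filled j + y) => [|m]; first by have := ltn_filled j; lia.
  rewrite -E -addnA; congr (_ + _).
  have lej : j < filled j + y by have := ltn_filled j; lia.
  rewrite (big_ord_widen _ (fun i => g (cap i)) (ltnW lej)).
  rewrite (bigID (fun i : 'I_ _ => i < j)) /=; congr (_ + _).
    apply: eq_bigr => i ij; congr g; have := leq_filled ij; rewrite filledS; lia.
  rewrite (bigD1 (Ordinal lej)) ?ltnn //= big1 ?addn0.
    by congr g; lia.
  move=> i /andP[ij nij]; have ji : j < i.
    by rewrite ltn_neqAle leqNgt ij andbT eq_sym; apply: contraNneq nij => e;
      apply/eqP/val_inj.
  have := leq_filled ji; rewrite filledS => le2.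
  by rewrite (_ : _ - _ = 0) ?min0n //; lia.
by move=> lex; have := aux 0 (leq0n _); rewrite g0 !addn0 (aux x lex) => ->.
Qed.

Lemma filling_cost1 : G 1 = c.
Proof. by rewrite /G big_ord1 /filled big_ord0 subnn min0n g0 addn0. Qed.

Hypothesis g_subadd : forall a b, g (a + b) <= g a + g b.
Hypothesis g_exchange : forall j a b, a <= cap j -> b <= cap j ->
  cap j <= a + b -> g (cap j) + g (a + b - cap j) <= g a + g b.

(** The top of [x] lies in a layer [t >= j], with at least the capacity of layer [j]. If [y] fits
    there, subadditivity of [g] suffices; otherwise the layer is completed and [g_exchange] pays for
    the overflow. *)
Lemma leq_filling_costD j x y :
  filled j <= x -> y <= cap j -> G (x + y) <= G x + g y.
Proof.
move=> lejx leyj.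
have x_gt0 : 0 < x by have := ltn_filled j; lia.
have [t [x' [Ex ltx]]] := filled_level x_gt0.
have lejt : j <= t.
  rewrite leqNgt; apply/negP => /leq_filled; rewrite filledS; lia.
have leyt := leq_trans leyj (leq_cap lejt).
rewrite Ex filling_costD ?(ltnW ltx) //.
have [le1|gt1] := leqP (x' + y) (cap t).
  by rewrite -addnA filling_costD // -addnA leq_add2l g_subadd.
have -> : filled t + x' + y = filled t.+1 + (x' + y - cap t).
  by rewrite filledS; lia.
rewrite filling_costD; last by have := leq_cap (leqnSn t); lia.
rewrite filledS filling_costD //.
by have := g_exchange (ltnW ltx) leyt (ltnW gt1); lia.
Qed.

Hypothesis leq_g1 : g 1 <= c.

Lemma filling_cost_subadd a b : G (a + b) <= G a + G b.
Proof.
elim/ltn_ind: b => -[|[|b]] IH; first by rewrite addn0 leq_addr.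
  rewrite filling_cost1; case: a {IH} => [|a]; first by rewrite filling_cost1.
  have := @leq_filling_costD 0 a.+1 1; rewrite cap_gt0 /filled big_ord0.
  by move=> /(_ isT isT) le1; apply: leq_trans le1 _; rewrite leq_add2l.
have [j [x [Eb x_gt0 lex]]] := @filled_level_pos b.+2 isT.
have ltb : filled j < b.+2 by rewrite Eb; lia.
have := leq_filling_costD (leq_addl a (filled j)) lex; have := IH _ ltb.
by rewrite Eb filling_costD // addnA; lia.
Qed.

(** A mixed exchange: [a] is paid by [g] within one layer, [b] by the whole cost [G]. The layer is
    completed with units taken from [b], one layer of [b] after another from the top. *)
Lemma filling_cost_swap n a b : a <= cap n -> b <= filled n ->
  cap n <= a + b -> g (cap n) + G (a + b - cap n) <= g a + G b.
Proof.
elim/ltn_ind: b a => -[|[|b]] IH a lea leb le_ab.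
- have -> : a = cap n by lia.
  by rewrite !addn0 subnn filling_cost0 addn0.
- have [->|neq] := eqVneq a (cap n); first by rewrite addKn.
  rewrite (_ : _ - _ = 0) ?addn0; last by lia.
  rewrite (_ : cap n = a + 1); last by lia.
  by apply: leq_trans (g_subadd _ _) _; rewrite filling_cost1 leq_add2l.
have [t [x [Eb x_gt0 lex]]] := @filled_level_pos b.+2 isT.
have letn : t <= n.
  rewrite leqNgt; apply/negP => /leq_filled; rewrite filledS.
  by have := cap_gt0 n; lia.
have lext := leq_trans lex (leq_cap letn).
rewrite Eb filling_costD //.
have [le1|gt1] := leqP (cap n) (a + x).
  rewrite (_ : _ - _ = filled t + (a + x - cap n)); last by lia.
  rewrite filling_costD; last by lia.
  by have := g_exchange lea lext le1; lia.
have := IH (filled t) _ (a + x) (ltnW gt1).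
rewrite Eb -[X in X < _]addn0 ltn_add2l => /(_ x_gt0 (leq_filled letn)).
rewrite -addnA (addnC x); have := g_subadd a x; lia.
Qed.

(** This reproduces [g_exchange] one dimension higher, with [filled n] as the capacity. The cases
    are which of [a] and [b] reach into the last layer. *)
Lemma filling_cost_exchange n a b : a <= filled n -> b <= filled n ->
  filled n <= a + b -> G (filled n) + G (a + b - filled n) <= G a + G b.
Proof.
elim: n a b => [|n IH] a b.
  rewrite (_ : filled 0 = 1) /filled ?big_ord0 // => la lb lab.
  have [->|neq] := eqVneq a 1; first by rewrite addKn.
  have -> : b = 1 by lia.
  by rewrite addnK addnC.
rewrite !filledS => lea leb leab; rewrite filling_costD //.
wlog leba : a b lea leb leab / b <= a.
  move=> W; case: (leqP b a) => [/W -> //|/ltnW leab'].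
  have := W b a leb lea; rewrite (addnC b a) => /(_ leab leab').
  by rewrite (addnC (G b)).
have [leDb|ltbD] := leqP (filled n) b.
  have [a' Ea] : exists a', a = filled n + a' by exists (a - filled n); lia.
  have [b' Eb] : exists b', b = filled n + b' by exists (b - filled n); lia.
  have lea' : a' <= cap n by lia.
  have leb' : b' <= cap n by lia.
  rewrite Ea Eb !filling_costD //.
  have [le1|gt1] := leqP (cap n) (a' + b').
    rewrite (_ : _ - _ = filled n + (a' + b' - cap n)); last by lia.
    rewrite filling_costD; last by lia.
    by have := g_exchange lea' leb' le1; lia.
  have := @filling_cost_swap n (a' + b') (filled n) (ltnW gt1) (leqnn _).
  rewrite (_ : _ - (_ + _) = a' + b' + filled n - cap n); last by lia.
  by have := g_subadd a' b'; lia.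
have [leDa|ltaD] := leqP (filled n) a.
  have [a' Ea] : exists a', a = filled n + a' by exists (a - filled n); lia.
  have lea' : a' <= cap n by lia.
  rewrite Ea filling_costD //.
  have := @filling_cost_swap n a' b lea' (ltnW ltbD).
  by rewrite (_ : _ - (_ + _) = a' + b - cap n); lia.
have := IH a b (ltnW ltaD) (ltnW ltbD).
have := @filling_cost_swap n 0 (a + b - filled n) isT.
by rewrite g0 add0n (_ : a + b - (_ + _) = a + b - filled n - cap n); lia.
Qed.

End Filling.

(** * The least number of faces forced by independent top cycles *)

Definition shift_faces (f : nat -> nat -> nat) k m :=
  if k is k'.+1 then f k' m else 0.

(** The number of top cliques with largest vertex [d.+1 + i] in a Turan graph with [d.+1] parts. *)
Definition layer_cap d i := layer_size d (i - i %/ d.+1).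

(* Faces are counted by cardinality k. For d = 0 only m <= 1 occurs; the value m
   in the other cases keeps the recursion uniform. *)
Fixpoint min_faces d k m :=
  if d is d'.+1 then
    filling_cost (layer_cap d') (shift_faces (min_faces d') k)
      ('C(d, k) * 2 ^ k) m
  else (k == 0) * m.

Definition link_faces d := shift_faces (min_faces d).

Lemma min_facesS d k :
  min_faces d.+1 k = filling_cost (layer_cap d) (link_faces d k) ('C(d.+1, k) *
    2 ^ k).
Proof. by []. Qed.

Lemma layer_sizeE_filled d j : layer_size d.+1 j = filled (layer_cap d) j.
Proof. by []. Qed.

Lemma layer_cap_gt0 d j : 0 < layer_cap d j.
Proof. exact: layer_size_gt0. Qed.

Lemma leq_layer_cap d : {homo layer_cap d : i j / i <= j}.
Proof. by move=> i j leij; apply/leq_layer_size/subn_divn_homo. Qed.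

Lemma min_faces0 d k : min_faces d k 0 = 0.
Proof. by case: d => //=; rewrite muln0. Qed.

Lemma link_faces0 d k : link_faces d k 0 = 0.
Proof. by case: k => // k; apply: min_faces0. Qed.

Lemma min_faces1 d k : min_faces d k 1 = 'C(d, k) * 2 ^ k.
Proof.
case: d => [|d]; first by case: k => //= k.
by rewrite min_facesS filling_cost1 ?link_faces0.
Qed.

Lemma link_faces1 d k : link_faces d k 1 <= 'C(d.+1, k) * 2 ^ k.
Proof.
case: k => // k; rewrite /link_faces /shift_faces min_faces1 binS expnS; nia.
Qed.

Lemma leq_min_faces d k : {homo min_faces d k : a b / a <= b}.
Proof.
elim: d k => [|d IH] k a b leab /=; first by rewrite leq_mul2l leab orbT.
apply: leq_filling_cost leab => {a b} a b leab.
by case: k => //= k; apply: IH.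
Qed.

(** The capacities [layer_cap d j] are values of [layer_size d], so the exchange property for [d] is
    the hypothesis on [g] needed for [d.+1]; both properties therefore go through the induction
    together. *)
Lemma min_faces_props d k :
  (forall a b, min_faces d k (a + b) <= min_faces d k a + min_faces d k b) /\
  (forall j a b, a <= layer_size d j -> b <= layer_size d j ->
   layer_size d j <= a + b ->
   min_faces d k (layer_size d j) + min_faces d k (a + b - layer_size d j)
     <= min_faces d k a + min_faces d k b).
Proof.
elim: d k => [|d IH] k.
  rewrite /=; split=> [a b|_ a b la lb lab];
    by case: (k == 0); rewrite ?mul1n ?mul0n //; lia.
have sub a b : link_faces d k (a + b) <= link_faces d k a + link_faces d k b.
  by case: (k) => // k'; case: (IH k') => + _; apply.
have exch j a b : a <= layer_cap d j -> b <= layer_cap d j ->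
    layer_cap d j <= a + b ->
    link_faces d k (layer_cap d j) + link_faces d k (a + b - layer_cap d j)
      <= link_faces d k a + link_faces d k b.
  by case: (k) => // k'; case: (IH k') => _ h; apply: h.
split=> [a b|j a b].
  exact: (filling_cost_subadd (layer_cap_gt0 d) (@leq_layer_cap d)
    (link_faces0 d k) sub exch (link_faces1 d k)).
exact: (filling_cost_exchange (layer_cap_gt0 d) (@leq_layer_cap d)
    (link_faces0 d k) sub exch (link_faces1 d k)).
Qed.

Lemma leq_min_facesD d k j x y : layer_size d.+1 j <= x -> y <= layer_cap d j ->
  min_faces d.+1 k (x + y) <= min_faces d.+1 k x + link_faces d k y.
Proof.
apply: leq_filling_costD.
- exact: layer_cap_gt0.
- exact: leq_layer_cap.
- exact: link_faces0.
- by case: k => // k a b; case: (min_faces_props d k) => + _; apply.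
- by case: k => // k i a b; case: (min_faces_props d k) => _; apply.
Qed.

Lemma min_facesD d k j x : x <= layer_cap d j ->
  min_faces d.+1 k (layer_size d.+1 j + x) =
  min_faces d.+1 k (layer_size d.+1 j) + link_faces d k x.
Proof.
apply: filling_costD; [exact: layer_cap_gt0 | exact: link_faces0].
Qed.

Lemma layer_size_quot d j : layer_size d.+1 j = (1 + j %/ d.+1) * layer_cap d j.
Proof. exact: layer_size_mul. Qed.

Lemma layer_capS d j : layer_cap d.+1 (j + (1 + j %/ d.+1)) = layer_size d.+1 j.+1.
Proof.
rewrite /layer_cap; congr layer_size.
have := divn_eq j d.+1; have := ltn_mod j d.+1; set a := j %/ _; set c := j %% _.
move=> /= ltc Ej.
have -> : j + (1 + a) = a * d.+2 + c.+1 by lia.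
by rewrite divnMDl // divn_small; lia.
Qed.

(** The parts of T_(d+1)(d+1+j) have [2 + j %/ d.+1] vertices or one less, so adding a part of that
    size gives a Turan graph again and multiplies the number of top cliques by it. *)
Lemma layer_size_next d j :
  layer_size d.+2 (j + (1 + j %/ d.+1)) = (2 + j %/ d.+1) * layer_size d.+1 j.
Proof.
rewrite layer_size_quot layer_capS.
have -> : (j + (1 + j %/ d.+1)) %/ d.+2 = j %/ d.+1.
  have := divn_eq j d.+1; have := ltn_mod j d.+1.
  set a := j %/ _; set c := j %% _ => /= ltc Ej.
  have -> : j + (1 + a) = a * d.+2 + c.+1 by lia.
  by rewrite divnMDl // divn_small; lia.
rewrite layer_sizeS -/(layer_cap d j) layer_size_quot; ring.
Qed.

Lemma min_faces_dim0 k m : min_faces 0 k m = (k == 0) * m.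
Proof. by []. Qed.

Arguments min_faces : simpl never.

(* A lower bound for the faces of a complex with d + 1 colours in which a vertex
   of colour 1 has a link with b independent cycles and the other vertices of
   colour 1 have links with the numbers of cycles listed in s. *)
Definition layered_faces d k b s :=
  min_faces d k b + link_faces d k b + \sum_(x <- s) link_faces d k x.

Definition layered d k b s := all (leq^~ b) s ->
  min_faces d.+1 k (sumn s) <= layered_faces d k b s.

Lemma layered_faces_cat d k b i s t :
  layer_size d.+1 i <= sumn s -> all (leq^~ (layer_cap d i)) t ->
  min_faces d.+1 k (sumn s) <= layered_faces d k b s ->
  min_faces d.+1 k (sumn (s ++ t)) <= layered_faces d k b (s ++ t).
Proof.
move=> les let_ H; elim: t let_ => [|x t IH] /=; first by rewrite cats0.
move=> /andP[lex /IH]; rewrite /layered_faces !sumn_cat !big_cat /= big_cons => le1.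
have := @leq_min_facesD d k i (sumn s + sumn t) x.
rewrite (leq_trans les (leq_addr _ _)) => /(_ isT lex).
by rewrite (_ : sumn s + (x + _) = sumn s + sumn t + x); lia.
Qed.

Lemma layered_perm d k b s t : perm_eq s t ->
  layered_faces d k b s = layered_faces d k b t.
Proof. by move=> st; rewrite /layered_faces (perm_big _ st). Qed.

(** All entries are 0 or 1. The first unit costs a cross-polytope, the suspension of the one in the
    link: [min_faces d k 1] and two copies of the link. Later units cost at most a link each. *)
Lemma layered1 d k b s : b <= 1 -> layered d k b s.
Proof.
move=> leb; rewrite /layered; elim: s => [|x s IH] /=; first by rewrite min_faces0.
move=> /andP[lex les]; have := IH les; rewrite /layered_faces big_cons => le1.
case: x lex => [|[|x]] lex; last by lia.
  by rewrite add0n link_faces0 add0n.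
case: (posnP (sumn s)) => [->|s_gt0].
  have -> : b = 1 by lia.
  rewrite addn0 !min_faces1; case: (k) => [|k'].
    by rewrite !bin0.
  by rewrite /link_faces /shift_faces min_faces1 binS expnS; nia.
have := @leq_min_facesD d k 0 (sumn s) 1.
rewrite layer_cap_gt0 layer_sizeE_filled /filled big_ord0 s_gt0 => /(_ isT isT).
by rewrite addnC; lia.
Qed.

(** With one colour, [m > 0] cycles need [m.+1] points; for [k = 1] the right side is [b + sumn s]
    with [b > 1]. *)
Lemma layered0 k b s : layered 0 k b s.
Proof.
move=> les; have [/layered1|b_gt1] := leqP b 1; first exact.
rewrite min_facesS /layered_faces.
case: (posnP (sumn s)) => [-> //|s_gt0].
case: k => [|[|k]] /=.
- case E: (sumn s) => [|m] //=; rewrite min_faces_dim0 mul1n expn0 big1 ?addn0 //.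
  by lia.
- case E: (sumn s) => [|m] //=; rewrite /link_faces /= !min_faces_dim0 add0n bin1.
  have -> : \sum_(x <- s) min_faces 0 0 x = m.+1.
    by rewrite -E sumnE; apply: eq_bigr => i _; rewrite min_faces_dim0 mul1n.
  apply: (@leq_trans (2 + \sum_(i < m.+1) (i < m))).
    rewrite leq_add // leq_sum // => i _; rewrite min_faces_dim0 mul1n /filled.
    rewrite /layer_cap /= sum1_card card_ord.
    by have := ltn_ord i; case: (ltnP i m); lia.
  rewrite big_ord_recr /= ltnn addn0.
  rewrite (eq_bigr (fun=> 1)); last by move=> i _; rewrite ltn_ord.
  by rewrite sum1_card card_ord mul1n; lia.
- case E: (sumn s) => [|m] //=.
  by rewrite big1 // => i _; rewrite /link_faces /= min_faces_dim0 mul0n.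
Qed.

Lemma sumn_truncate D s :
  sumn s = sumn (map (minn D) s) + sumn (map (subn^~ D) s).
Proof. by elim: s => //= z s IH; rewrite IH; lia. Qed.

(** All heights are at most [D + x], and the units above [D] lie in a single layer, where they are
    paid by link costs. These link costs form a layered configuration with one colour less. *)
Lemma layered_faces_peel d k j x s : x <= layer_cap d j ->
  all (leq^~ (layer_size d.+1 j + x)) s ->
  layered_faces d.+1 k.+1 (layer_size d.+1 j + x) s =
  layered_faces d.+1 k.+1 (layer_size d.+1 j)
    (map (minn (layer_size d.+1 j)) s) +
  layered_faces d k x (map (subn^~ (layer_size d.+1 j)) s).
Proof.
set D := layer_size d.+1 j => lex les.
rewrite /layered_faces min_facesD // /link_faces /shift_faces !min_facesD //.
rewrite !big_map -/D.
have -> : \sum_(z <- s) min_faces d.+1 k z =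
    \sum_(z <- s) min_faces d.+1 k (minn D z) +
    \sum_(z <- s) link_faces d k (z - D).
  rewrite -big_split /=; apply: eq_big_seq => z /(allP les) lez.
  have [leD|ltD] := leqP D z; last first.
    by rewrite (_ : z - D = 0) ?link_faces0 ?addn0 //; lia.
  by rewrite -min_facesD ?subnKC //; lia.
by rewrite /link_faces /shift_faces; lia.
Qed.

Lemma all_leq_map_minn D s : all (leq^~ D) (map (minn D) s).
Proof. by apply/allP => _ /mapP[z _ ->]; rewrite geq_minl. Qed.

Lemma all_leq_map_subn D x s :
  all (leq^~ (D + x)) s -> all (leq^~ x) (map (subn^~ D) s).
Proof. by move=> les; apply/allP => _ /mapP[z /(allP les) le1 ->]; lia. Qed.

Lemma sumn_map_subn_leq D x s : all (leq^~ (D + x)) s ->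
  sumn (map (subn^~ D) s) <= count (ltn D) s * x.
Proof. by elim: s => //= z s IH /andP[lez /IH]; case: (ltnP D z); nia. Qed.

Lemma layeredP d k b s : layered d k b s.
Proof.
elim: d k b s => [|d IHd] [|k] b s; try exact: layered0.
  move=> les; case: (posnP (sumn s)) => [->|s_gt0]; first by rewrite min_faces0.
  have b_gt0 : 0 < b.
    case: b les => // les; move: s_gt0; rewrite sumnE big1_seq // => z /= zs.
    by apply/eqP; rewrite -leqn0 (allP les).
  have := leq_min_faces d.+1 0 b_gt0; rewrite min_faces1 bin0 expn0 /layered_faces.
  have : min_faces d.+2 0 (sumn s) <= 1; last by lia.
  by rewrite min_facesS /filling_cost; case: (sumn s) => // m; rewrite big1.
elim/ltn_ind: b s => b IHb s les.
have [/layered1/(_ les) //|b_gt1] := leqP b 1.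
have [j [x [Eb x_gt0 lex]]] := filled_level_pos (layer_cap_gt0 d) b_gt1.
rewrite -layer_sizeE_filled in Eb; set D := layer_size d.+1 j in Eb.
have DE : D = (1 + j %/ d.+1) * layer_cap d j := layer_size_quot d j.
have ltDb : D < b by rewrite Eb; lia.
(* The part of the configuration above height D is itself layered, in one
   dimension less, so it costs at least as much as a single new layer of y. *)
have peel t : all (leq^~ b) t ->
    layered_faces d.+1 k.+1 D (map (minn D) t) +
    link_faces d.+1 k.+1 (sumn (map (subn^~ D) t)) <=
    layered_faces d.+1 k.+1 b t.
  move=> let_; rewrite Eb layered_faces_peel -?Eb // leq_add2l.
  by apply: IHd; apply: all_leq_map_subn; rewrite -Eb.
(* If few entries exceed [D], their total excess [y] is at most
   [(1 + j %/ d.+1) * layer_cap d j = D], so it can serve as one new entry under the smaller bound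
   [D]. *)
have [few|many] := leqP (count (ltn D) s) (1 + j %/ d.+1).
  set y := sumn (map (subn^~ D) s).
  have leyD : y <= D.
    have := @sumn_map_subn_leq D x s; rewrite -Eb => /(_ les).
    by move=> le1; apply: leq_trans le1 _; rewrite {2}DE leq_mul.
  have le1 : all (leq^~ D) (y :: map (minn D) s).
    by apply/andP; split=> //; apply: all_leq_map_minn.
  have -> : sumn s = sumn (y :: map (minn D) s).
    by rewrite (sumn_truncate D s) addnC.
  apply: leq_trans (IHb D ltDb _ le1) _.
  by apply: leq_trans (peel s les); rewrite -/y /layered_faces big_cons; lia.
pose q := 1 + j %/ d.+1.
pose big := filter (ltn D) s.
have size_big : q < size big by rewrite size_filter.
(* Truncated at [D], these entries sum to [q.+1 * D], the completed level [j + q] one dimension up.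
   Their excess fits into the next layer, of capacity [D + layer_cap d j], and so does each
   remaining entry. *)
pose t := take q.+1 big.
have size_t : size t = q.+1 by rewrite size_takel.
have tD z : z \in t -> D < z by move=> /mem_take; rewrite mem_filter => /andP[].
have perm_s : perm_eq s (t ++ (drop q.+1 big ++ filter (predC (ltn D)) s)).
  by rewrite catA cat_take_drop perm_sym perm_filterC.
have sub_s z : z \in t ++ (drop q.+1 big ++ filter (predC (ltn D)) s) -> z <= b.
  by rewrite -(perm_mem perm_s) => /(allP les).
rewrite (perm_sumn perm_s) (layered_perm _ _ _ perm_s).
have capE : layer_cap d.+1 (j + q) = D + layer_cap d j.
  by rewrite layer_capS layer_sizeS.
have sizeE : layer_size d.+2 (j + q) = q.+1 * D by rewrite layer_size_next.
have let_ : all (leq^~ b) t.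
  by apply/allP => z zt; apply: sub_s; rewrite mem_cat zt.
have minE : map (minn D) t = nseq q.+1 D.
  rewrite -size_t; apply: (@eq_from_nth _ 0);
    rewrite ?size_map ?size_nseq // => i it.
  rewrite (nth_map 0) // nth_nseq it.
  exact/minn_idPl/ltnW/tD/mem_nth.
have sum_minE : sumn (map (minn D) t) = layer_size d.+2 (j + q).
  by rewrite minE sumn_nseq sizeE mulnC.
apply: (@layered_faces_cat _ _ _ (j + q)).
- by rewrite (sumn_truncate D t) sum_minE leq_addr.
- apply/allP => z zs; rewrite capE; apply: (@leq_trans b);
  last by rewrite Eb leq_add2l.
  by apply: sub_s; rewrite mem_cat zs orbT.
apply: leq_trans (peel _ let_).
apply: (@leq_trans (min_faces d.+2 k.+1 (sumn (map (minn D) t)) +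
                    link_faces d.+1 k.+1 (sumn (map (subn^~ D) t)))).
  rewrite {1}(sumn_truncate D t); apply: (@leq_min_facesD _ _ (j + q)).
    by rewrite sum_minE.
  rewrite Eb in let_; apply: leq_trans (sumn_map_subn_leq let_) _.
  have : count (ltn D) t <= q.+1 by rewrite -size_t count_size.
  by rewrite capE DE -/q; nia.
by rewrite leq_add2r; apply: IHb => //; apply: all_leq_map_minn.
Qed.

(** * Cycles of coloured complexes *)

Section ColoredFaces.

Variables (U : eqType) (V : seq U).
Implicit Types (W : pred (seq (option U))) (F : seq (option U)).

(* A face of a d-coloured complex is a list of length d whose i-th entry is its
   vertex of colour i, if any. *)
Fixpoint colored_faces d k W : seq (seq (option U)) :=
  if d is d'.+1 then
    map (cons None) (colored_faces d' k (fun F => W (None :: F))) ++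
    (if k is k'.+1 then
       [seq Some v :: F | v <- V,
                          F <- colored_faces d' k' (fun F => W (Some v :: F))]
     else [::])
  else if (k == 0) && W [::] then [:: [::]] else [::].

Lemma size_colored_facesS d k W :
  size (colored_faces d.+1 k W) =
  size (colored_faces d k (fun F => W (None :: F))) +
  \sum_(v <- V) shift_faces
    (fun k' _ => size (colored_faces d k' (fun F => W (Some v :: F)))) k 0.
Proof.
rewrite /= size_cat size_map; congr (_ + _); case: k => [|k] /=.
  by rewrite big1.
by rewrite size_allpairs_dep sumnE big_map.
Qed.

Lemma leq_size_colored_faces d k W W' : (forall F, W F -> W' F) ->
  size (colored_faces d k W) <= size (colored_faces d k W').
Proof.
elim: d k W W' => [|d IH] k W W' sW; last first.
  rewrite !size_colored_facesS leq_add ?IH //; first by move=> F; apply: sW.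
  apply: leq_sum => v _; case: k => //= k; apply: IH => F; apply: sW.
by rewrite /=; case: (_ == _) => //=; case: ifP => // /sW->.
Qed.

Lemma colored_facesP d k W F : F \in colored_faces d k W ->
  [/\ W F, size F = d, count isSome F = k & {subset pmap id F <= V}].
Proof.
elim: d k W F => [|d IH] k W F /=.
  by case: ifP => // /andP[/eqP-> WF]; rewrite inE => /eqP->.
rewrite mem_cat => /orP[/mapP[F' /IH[WF' <- <- sF'] ->]|] //.
case: k => // k /allpairsPdep[v [F' [vV /IH[WF' <- <- sF'] ->]]].
split=> //= u; rewrite inE => /predU1P[-> //|]; exact: sF'.
Qed.

Lemma colored_faces_uniq d k W : uniq V -> uniq (colored_faces d k W).
Proof.
move=> uV; elim: d k W => [|d IH] k W /=; first by case: ifP.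
rewrite cat_uniq map_inj_uniq ?IH => [|? ? []] //=.
case: k => //= k; apply/andP; split.
  apply/hasPn => _ /allpairsPdep[v [F' [_ _ ->]]].
  by apply/negP => /mapP[].
apply: allpairs_uniq_dep => //.
by move=> [v F] [v' F'] _ _ /= [-> ->].
Qed.

Section Cycles.
Variables (K : fieldType) (p : nat).
Implicit Type c : seq U -> 'rV[K]_p.

(** [c] packs [p] chains into one vector-valued function. As row and column ranks agree, the rank of
    the span of its values is the dimension of the space generated by these chains. *)
Fixpoint chain_span d c : 'M[K]_p :=
  if d is d'.+1 then (\sum_(v <- V) chain_span d' (fun x => c (v :: x)%SEQ))%MS
  else <<c [::]>>%MS.

Definition colored_cycle d c := forall w x, (size w + size x).+1 = d ->
  (\sum_(v <- V) c (w ++ v :: x)%SEQ = 0)%R.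

Lemma sub_sumsmx_seq (I : eqType) (s : seq I) (A : I -> 'M[K]_p) m
    (B : 'M[K]_(m, p)) i :
  i \in s -> (B <= A i)%MS -> (B <= \sum_(j <- s) A j)%MS.
Proof.
move=> si sBA; rewrite (big_rem _ si) /=.
exact: submx_trans sBA (addsmxSl _ _).
Qed.

Lemma sumsmx_seq_subP (I : eqType) (s : seq I) (A : I -> 'M[K]_p) m
    (B : 'M[K]_(m, p)) :
  {in s, forall i, (A i <= B)%MS} -> (\sum_(j <- s) A j <= B)%MS.
Proof.
elim: s => [|i s IH] sAB; first by rewrite big_nil sub0mx.
rewrite big_cons addsmx_sub sAB ?mem_head // IH // => j js.
by apply: sAB; rewrite inE js orbT.
Qed.

Lemma mxrank_sums_seq (I : Type) (s : seq I) (A : I -> 'M[K]_p) :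
  \rank (\sum_(j <- s) A j)%MS <= \sum_(j <- s) \rank (A j).
Proof.
elim: s => [|i s IH]; first by rewrite !big_nil mxrank0.
rewrite !big_cons; apply: leq_trans (mxrank_adds_leqif _ _) _.
by rewrite leq_add2l.
Qed.

Lemma sub_chain_span d c x : size x = d -> {subset x <= V} ->
  (c x <= chain_span d c)%MS.
Proof.
elim: d c x => [|d IH] c [|v x] //= => [_ _|[sx] sxV]; first by rewrite genmxE.
apply: (@sub_sumsmx_seq _ _ _ _ _ v); first by apply: sxV; rewrite mem_head.
by apply: (IH (fun x => c (v :: x))) => // u ux; apply: sxV; rewrite inE ux orbT.
Qed.

Lemma chain_span_subP d c m (B : 'M[K]_(m, p)) :
  (forall x, size x = d -> {subset x <= V} -> (c x <= B)%MS) ->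
  (chain_span d c <= B)%MS.
Proof.
elim: d c => [|d IH] c sB /=; first by rewrite genmxE sB.
apply: sumsmx_seq_subP => v vV; apply: IH => x sx sxV; apply: sB => /=.
  by rewrite sx.
by move=> u; rewrite inE => /predU1P[-> //|/sxV].
Qed.

Lemma argmax_seq (s : seq U) (f : U -> nat) v : v \in s ->
  exists2 u, u \in s & {in s, forall w, f w <= f u}.
Proof.
elim: s v => // a s IH v _; case: s IH => [|b s] IH.
  by exists a; rewrite ?mem_head // => w; rewrite inE => /eqP->.
have [u us mu] := IH b (mem_head _ _).
have [leau|ltua] := leqP (f a) (f u).
  exists u; first by rewrite inE us orbT.
  by move=> w; rewrite inE => /predU1P[->|/mu].
exists a; rewrite ?mem_head // => w; rewrite inE => /predU1P[->//|/mu le1].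
exact: leq_trans le1 (ltnW ltua).
Qed.

(* Colour 1 contributes the links of its vertices, and the faces without colour
   1 include the link of any one of them, here of a vertex v0 whose link carries
   the most cycles. Since the coefficients at the vertices of colour 1 add up to
   zero, the vertices other than v0 already span all the cycles. *)
Lemma min_faces_leq_colored_faces d k W c :
  (forall x, size x = d -> c x != 0%R -> W (map some x)) ->
  (forall F v F', W (F ++ Some v :: F') -> W (F ++ None :: F')) ->
  colored_cycle d c ->
  min_faces d k (\rank (chain_span d c)) <= size (colored_faces d k W).
Proof.
elim: d k W c => [|d IH] k W c supp down cyc.
  rewrite min_faces_dim0 /= genmxE; case: (k == 0) => //=.
  have [->|nz] := eqVneq (c [::]) 0%R; first by rewrite mxrank0.
  by rewrite (supp [::] erefl nz : W [::]) mul1n rank_leq_row.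
have [V0|[v vV]] : (forall v, v \notin V) \/ exists v, v \in V.
  by case: (V) => [|v s]; [left | right; exists v; rewrite mem_head].
  rewrite (_ : \rank _ = 0) ?min_faces0 //; apply/eqP; rewrite -leqn0.
  apply: leq_trans (mxrank_sums_seq _ _) _.
  by rewrite big1_seq // => u /andP[_ uV]; have := V0 u; rewrite uV.
pose r v := \rank (chain_span d (fun x => c (v :: x))).
have [v0 v0V maxr] := @argmax_seq V r v vV.
have IHr u k' : min_faces d k' (r u) <=
    size (colored_faces d k' (fun F => W (Some u :: F))).
  apply: IH => [x sx nz|F w F'|w x swx].
  - by apply: (supp (u :: x)) => //=; rewrite sx.
  - exact: (down (Some u :: F)).
  - by apply: (cyc (u :: w)); rewrite /= -swx.
have rank_le : \rank (chain_span d.+1 c) <= sumn (map r (rem v0 V)).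
  rewrite sumnE big_map; apply: leq_trans (mxrank_sums_seq _ _).
  apply: mxrankS; rewrite /= (big_rem _ v0V) /= addsmx_sub submx_refl andbT.
  apply: chain_span_subP => x sx sxV.
  have := cyc [::] x; rewrite /= sx (big_rem _ v0V) => /(_ erefl) /eqP.
  rewrite addr_eq0 => /eqP->; rewrite eqmx_opp big_seq; apply: summx_sub => u uV.
  apply: (@sub_sumsmx_seq _ _ _ _ _ u) => //.
  exact: (@sub_chain_span d (fun x => c (u :: x))).
apply: leq_trans (leq_min_faces _ _ rank_le) _.
have le_r : all (leq^~ (r v0)) (map r (rem v0 V)).
  by apply/allP => _ /mapP[u /mem_rem uV ->]; apply: maxr.
apply: leq_trans (@layeredP d k _ _ le_r) _.
rewrite size_colored_facesS (big_rem _ v0V) /layered_faces big_map /= -addnA.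
apply: leq_add.
  apply: leq_trans (leq_size_colored_faces _ _ _) => [|F]; first exact: IHr.
  exact: (down [::] v0).
case: (k) => [|k']; first by rewrite /= !big1.
by rewrite leq_add ?leq_sum // => *; apply: IHr.
Qed.

End Cycles.
End ColoredFaces.

(** * From simplicial cycles to coloured cycles *)

Section TopCycles.

Variables (K : fieldType) (U : countType) (e : nat) (color : U -> nat).
Variable (D : {fset {fset U}}).
Hypothesis sD : forall A B : {fset U}, A `<=` B -> B \in D -> A \in D.
Hypothesis color_lt : forall u, color u < e.+1.
Hypothesis color_inj : forall A, A \in D -> {in A &, injective color}.

Let V : {fset U} := \bigcup_(A <- D) A.

Lemma mem_vertices A v : A \in D -> v \in A -> v \in V.
Proof. by move=> AD vA; apply/bigfcupP; exists A; rewrite ?AD. Qed.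

Lemma card_fset_count (A : {fset U}) (Q : pred U) :
  #|` [fset x in A | Q x]| = \sum_(x <- A) Q x.
Proof.
have -> : \sum_(x <- A) Q x = count Q A.
  by rewrite -sum1_count [RHS]big_mkcond; apply: eq_bigr => x _; case: (Q x).
rewrite -size_filter; apply: perm_size; apply: uniq_perm => [||x].
- exact: fset_uniq.
- exact/filter_uniq/fset_uniq.
by rewrite mem_filter !inE andbC.
Qed.

Definition inversions (B : {fset U}) : nat :=
  \sum_(x <- B) \sum_(y <- B)
    ((choice.pickle x < choice.pickle y) && (color y < color x)).

Definition face_sign (B : {fset U}) : K := ((-1) ^+ inversions B)%R.

Lemma inversionsU1 (a : {fset U}) v : v \notin a ->
  inversions (v |` a) = inversions a + \sum_(y <- a)
    (((choice.pickle v < choice.pickle y) && (color y < color v)) +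
     ((choice.pickle y < choice.pickle v) && (color v < color y))).
Proof.
move=> va; rewrite /inversions big_fsetU1 //= big_fsetU1 //= ltnn /= add0n.
rewrite big_split /= addnCA; congr (_ + _).
rewrite addnC -big_split /=; apply: eq_bigr => x _.
by rewrite big_fsetU1 //= addnC.
Qed.

Lemma incidenceU1 (a : {fset U}) v : v \notin a ->
  incidence K (v |` a) a =
  ((-1) ^+ #|` [fset y in v |` a | (choice.pickle y < choice.pickle v)%N]|)%R.
Proof.
move=> va; rewrite /incidence big_mkcond big_fsetU1 //=.
rewrite fsetU1K // eqxx big1_seq ?addr0 // => x /= xa.
case: eqP => // Ea; case/negP: (va); rewrite Ea !inE eqxx andbT.
by apply: contraNneq va => ->.
Qed.

(* Up to the sign of a permutation matching the order of the vertices with that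
   of their colours, the incidence sign depends only on the colour of v. *)
Lemma incidence_sign (a : {fset U}) v : v \notin a ->
  {in v |` a &, injective color} ->
  incidence K (v |` a) a =
  (face_sign (v |` a) * (-1) ^+ (inversions a + \sum_(y <- a) (color y < color
    v)%N))%R.
Proof.
move=> va inj; rewrite incidenceU1 // /face_sign -exprD.
rewrite card_fset_count big_fsetU1 //= ltnn add0n inversionsU1 //.
rewrite addnAC addnA addnn -addnA exprD -mul2n exprM sqrrN expr1n expr1n mul1r.
rewrite -signr_odd -[RHS]signr_odd; congr (_ ^+ _).
congr nat_of_bool; rewrite -big_split /= (big_morph odd oddD (erefl : odd 0 =
  false)) [RHS](big_morph odd oddD (erefl : odd 0 = false)).
apply: eq_big_seq => y ya; rewrite !oddD !oddb.
have nc : color y != color v.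
  apply: contraNneq va => /inj E; rewrite -E ?inE ?eqxx ?ya ?orbT //.
have np : choice.pickle y != choice.pickle v.
  by apply: contraNneq va => /(pcan_inj choice.pickleK)/= <-.
by case: ltngtP np => // _ _; case: ltngtP nc.
Qed.

(** The rows of the kernel matrix span the cycles; this vector collects the coefficients of all of
    them at [B]. *)
Definition cycle_row (B : {fset U}) : 'rV[K]_#|{: card_faces D e.+1}| :=
  if insub B is Some b then row (enum_rank b) (kermx (boundary K D e))^T else 0%R.

Lemma cycle_row_out B : B \notin card_faces D e.+1 -> cycle_row B = 0%R.
Proof. by move=> nB; rewrite /cycle_row insubN. Qed.

Lemma cycle_row_boundary (a : {fset U}) : a \in card_faces D e ->
  (\sum_(B <- card_faces D e.+1) incidence K B a *: cycle_row B = 0)%R.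
Proof.
move=> aD; rewrite big_seq_fsetE /=.
have /matrixP ker := mulmx_ker (boundary K D e).
apply/rowP => i; rewrite summxE mxE.
have E := ker i (enum_rank [` aD]); rewrite mxE [RHS]mxE in E; rewrite -[RHS]E {E}.
rewrite [RHS](reindex enum_rank) /=; last first.
  by exists enum_val => ? _; rewrite ?enum_rankK ?enum_valK.
apply: eq_bigr => b _; rewrite mxE /cycle_row /= insubT ?fsvalP // => p.
rewrite [boundary _ _ _ _ _]mxE !enum_rankK mulrC [row _ _ _ _]mxE [_^T _ _]mxE.
by congr (kermx _ i (enum_rank _) * _)%R; apply: val_inj.
Qed.

Lemma incidence_sumU1 (W : lmodType K) (w : {fset U} -> W) (a : {fset U}) :
  (forall B, B \notin card_faces D e.+1 -> w B = 0%R) ->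
  (\sum_(B <- card_faces D e.+1) incidence K B a *: w B =
   \sum_(v <- V | v \notin a) incidence K (v |` a) a *: w (v |` a))%R.
Proof.
move=> w0; under eq_bigr => B _ do rewrite scaler_suml.
transitivity (\sum_(B <- card_faces D e.+1) \sum_(v <- V | (v \notin a) && (B
  == v |` a))
   (-1) ^+ #|` [fset y in B | (choice.pickle y < choice.pickle v)%N]| *: w B)%R.
  apply: eq_big_seq => B BD.
  rewrite -[LHS]big_filter -[RHS]big_filter; apply: perm_big.
  apply: uniq_perm => [||x]; rewrite ?filter_uniq ?fset_uniq //.
  rewrite !mem_filter; apply/idP/idP.
    case/andP=> /eqP-> xB; rewrite !inE eqxx /= fsetD1K // eqxx /=.
    by apply: mem_vertices xB; move: BD; rewrite !inE => /andP[].
  by case/andP=> /andP[xa /eqP->] _; rewrite fsetU1K // eqxx !inE eqxx.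
rewrite (exchange_big_dep (fun v => v \notin a)) /=; last by move=> B v _ /andP[].
apply: eq_bigr => v va; rewrite va /= incidenceU1 //.
have [vD|vD] := boolP (v |` a \in card_faces D e.+1).
  rewrite big_mkcond (big_fsetD1 _ vD) /= eqxx big1_seq ?addr0 // => B.
  by rewrite !inE => /andP[_ /andP[/negPf->]].
rewrite w0 // scaler0 big1_seq // => B /andP[/eqP-> ].
by rewrite (negPf vD).
Qed.

(** The [e] vertices of [a] miss exactly one of the [e.+1] colours, so all [v] that complete [a] to
    a face share it. By [incidence_sign] the sign that remains beside [face_sign] is then common to
    all of them. *)
Lemma incidence_sum_sign (W : lmodType K) (w : {fset U} -> W) (a : {fset U}) :
  a \in card_faces D e -> (forall B, B \notin card_faces D e.+1 -> w B = 0%R) ->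
  exists2 s : K, s != 0%R &
  (\sum_(B <- card_faces D e.+1) incidence K B a *: w B =
   s *: \sum_(v <- V | v \notin a) face_sign (v |` a) *: w (v |` a))%R.
Proof.
move=> aD w0; rewrite incidence_sumU1 //.
have [none|[v1 [v1a v1D]]] : (forall v, v \notin a -> v |` a \notin D) \/
    exists v, v \notin a /\ v |` a \in D.
    have [/hasP[v _ /andP[va vD]]|/hasPn none] :=
        boolP (has (fun v => (v \notin a) && (v |` a \in D)) V).
      by right; exists v.
    left=> v va; apply/negP => vD; have vV : v \in V.
      by apply: (mem_vertices vD); rewrite !inE eqxx.
    by have := none v vV; rewrite va vD.
  exists 1%R; first exact: oner_neq0.
  rewrite scale1r !big1 // => v va; rewrite w0 ?scaler0 // !inE negb_and none //.
have same_color v : v \notin a -> v |` a \in D -> color v = color v1.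
  move=> va vD; apply/eqP/negPn/negP => nc.
  have uc : uniq (map color (v :: v1 :: a)).
    have inj u : u |` a \in D -> u \notin a -> color u \notin map color a.
      move=> uD ua; apply/mapP => -[x xa E]; case/negP: ua.
      by rewrite (color_inj uD _ _ E) // !inE ?eqxx ?xa ?orbT.
    rewrite /= inE negb_or nc !inj //= map_inj_in_uniq ?fset_uniq //.
    by move=> x y xa ya; apply: (color_inj v1D); rewrite !inE ?xa ?ya orbT.
  have sub : {subset map color (v :: v1 :: a) <= iota 0 e.+1}.
    by move=> c /(@mapP _ _ color (v :: v1 :: a))[x _ ->]; rewrite mem_iota /=.
  have := uniq_leq_size uc sub; rewrite size_map size_iota /=.
  by move: aD; rewrite !inE => /andP[_ /eqP ->]; rewrite ltnn.
pose s := ((-1) ^+ (inversions a + \sum_(y <- a) (color y < color v1)) : K)%R.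
exists s; first by rewrite signr_eq0.
rewrite scaler_sumr; apply: eq_bigr => v va.
have [vD|vD] := boolP (v |` a \in D); last first.
  by rewrite w0 ?scaler0 // !inE negb_and vD.
rewrite (incidence_sign va (color_inj vD)) scalerA mulrC.
by rewrite (same_color v va vD).
Qed.

Lemma cycle_row_sum (a : {fset U}) :
  (\sum_(v <- V | v \notin a) face_sign (v |` a) *: cycle_row (v |` a) = 0)%R.
Proof.
have [aD|naD] := boolP (a \in card_faces D e); last first.
  rewrite big1 // => v va; rewrite cycle_row_out ?scaler0 //.
  apply: contraNN naD; rewrite !inE => /andP[vaD]; rewrite cardfsU1 va.
  by rewrite eqSS => ->; rewrite (sD _ vaD) // fsubsetUr.
have [s s_neq0] := incidence_sum_sign aD cycle_row_out.
rewrite cycle_row_boundary // => /esym/eqP.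
by rewrite scaler_eq0 (negPf s_neq0) => /eqP.
Qed.

(** Keeping only tuples listed in the order of the colours makes each facet the value of exactly one
    tuple. *)
Definition color_cycle (x : seq U) : 'rV[K]_#|{: card_faces D e.+1}| :=
  let B := [fset u in x] in
  if map color x == iota 0 e.+1 then (face_sign B *: cycle_row B)%R else 0%R.

Lemma color_cycleP : colored_cycle (V : seq U) e.+1 color_cycle.
Proof.
move=> w x swx; pose a := [fset u in w ++ x].
have colE v : (map color (w ++ v :: x) == iota 0 e.+1) =
    [&& map color w == iota 0 (size w), color v == size w &
        map color x == iota (size w).+1 (size x)].
  rewrite -swx -addnS iotaD /= map_cat eqseq_cat ?size_map ?size_iota //=.
have [|ncol] := boolP ((map color w == iota 0 (size w)) &&
                    (map color x == iota (size w).+1 (size x))); last first.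
  rewrite big1 // => v _; rewrite /color_cycle colE.
  by rewrite andbCA (negPf ncol) andbF.
case/andP=> colw colx.
rewrite -[RHS](cycle_row_sum a) [RHS]big_mkcond; apply: eq_big_seq => v vV.
have aE : [fset u in w ++ v :: x] = v |` a.
  by apply/fsetP => u; rewrite !inE ?mem_cat ?inE; do !case: (_ \in _);
    rewrite ?orbT.
rewrite /color_cycle aE colE colw colx andbT /=.
have mem_a u : (u \in a) = (u \in w ++ x). by rewrite !inE mem_cat.
have [colv|ncolv] := eqVneq.
  case: ifP => // /negbFE va.
  have /eqP E : map color (w ++ v :: x) == iota 0 e.+1 by rewrite colE colw
    colv eqxx.
  have : uniq (w ++ v :: x) by apply: (@map_uniq _ _ color); rewrite E iota_uniq.
  by rewrite -cat1s uniq_catCA cat1s /= -mem_a va.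
(* A vertex outside [a] of any other colour repeats a colour of [a], so it cannot complete [a] to a
   face. *)
case: ifP => // va; rewrite cycle_row_out ?scaler0 // !inE negb_and.
apply/orP; left; apply/negP => vD.
have : color v \in map color (w ++ x).
  rewrite map_cat mem_cat (eqP colw) (eqP colx) !mem_iota /= add0n.
  by have := color_lt v; rewrite -swx;
    case: (ltngtP (color v) (size w)) ncolv => // *; lia.
case/mapP => y yx E; case/negP: (negbT (negbTE va)).
rewrite (color_inj vD _ _ E) ?mem_a // !inE ?eqxx // -?mem_cat ?yx ?orbT //.
Qed.

Lemma colored_enumeration B : B \in card_faces D e.+1 ->
  exists x : seq U, map color x = iota 0 e.+1 /\ [fset u in x] = B.
Proof.
rewrite !inE => /andP[BD /eqP sB].
exists (sort (relpre color leq) B); split; last first.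
  by apply/fsetP => u; rewrite !inE mem_sort.
rewrite -sort_map; apply: (sorted_eq leq_trans anti_leq).
- by apply: sort_sorted; apply: leq_total.
- exact: iota_sorted.
rewrite perm_sort.
have uB : uniq (map color B).
  by rewrite map_inj_in_uniq ?fset_uniq //; apply: color_inj.
apply: uniq_perm => //; first exact: iota_uniq.
have sub : {subset map color B <= iota 0 e.+1}.
  by move=> c /mapP[u _ ->]; rewrite mem_iota /=.
by case: (uniq_min_size uB sub); rewrite ?size_map ?size_iota ?sB.
Qed.

(** Transposition preserves rank, and each row of the transposed kernel matrix is, up to sign, the
    value of [color_cycle] at the enumeration of a facet by colour. *)
Lemma rank_cycles_leq :
  \rank (kermx (boundary K D e)) <=
  \rank (chain_span (V : seq U) e.+1 color_cycle).
Proof.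
rewrite -mxrank_tr; apply: mxrankS; apply/row_subP => i.
have BD := valP (enum_val i); set B := val (enum_val i) in BD.
have [x [colx xB]] := colored_enumeration BD.
have sx : size x = e.+1 by rewrite -(size_map color) colx size_iota.
have sxV : {subset x <= (V : seq U)}.
  move=> u ux; apply: (@mem_vertices B); first by move: BD; rewrite !inE => /andP[].
  by rewrite -xB !inE.
have := sub_chain_span color_cycle sx sxV.
rewrite /color_cycle colx eqxx xB.
have -> : cycle_row B = row i (kermx (boundary K D e))^T.
  rewrite /cycle_row insubT => /=.
  by congr row; rewrite -[RHS]enum_valK; congr enum_rank; apply: val_inj.
rewrite eqmx_scale //.
by rewrite /face_sign signr_eq0.
Qed.

Definition face_of (F : seq (option U)) : {fset U} := [fset u in pmap id F].

Definition in_complex (F : seq (option U)) : bool :=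
  [forall i : 'I_(size F), if nth None F i is Some v then color v == i else true]
  && (face_of F \in D).

Lemma in_complex_nth F i v : in_complex F -> nth None F i = Some v -> color v = i.
Proof.
case/andP=> /forallP col _ E; have [iF|Fi] := ltnP i (size F); last first.
  by rewrite nth_default in E.
by have := col (Ordinal iF); rewrite /= E => /eqP.
Qed.

Lemma mem_face_of F v : in_complex F ->
  (v \in face_of F) = (nth None F (color v) == Some v).
Proof.
move=> WF; rewrite !inE mem_pmap map_id; apply/idP/eqP => [/(nthP None)[i iF E]|E].
  by rewrite (in_complex_nth WF E).
rewrite -E mem_nth // ltnNge; apply/negP => le1.
by rewrite nth_default in E.
Qed.

Lemma in_complex_face_inj d : {in [pred F | in_complex F && (size F == d)] &,
  injective face_of}.
Proof.
move=> F F' /andP[WF /eqP sF] /andP[WF' /eqP sF'] E.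
apply: (@eq_from_nth _ None) => [|i _]; first by rewrite sF.
have sub G G' : in_complex G -> in_complex G' -> face_of G = face_of G' ->
    forall v, nth None G i = Some v -> nth None G' i = Some v.
  move=> WG WG' EG v Gv; have ci := in_complex_nth WG Gv.
  have : v \in face_of G by rewrite mem_face_of // ci Gv.
  by rewrite EG mem_face_of // ci => /eqP.
case EF: (nth None F i) => [v|]; first by rewrite (sub F F' WF WF' E v).
by case EF': (nth None F' i) => [v|] //; rewrite (sub F' F WF' WF (esym E) v) in EF.
Qed.

Lemma card_face_of F : in_complex F -> #|` face_of F| = count isSome F.
Proof.
move=> WF; rewrite -(size_pmap id); apply: perm_size; apply: uniq_perm.
- exact: fset_uniq.
- have := in_complex_nth WF; rewrite -[X in X -> _]/(forall i v, _ -> _ = 0 + i).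
  (* The first colour is generalised to [n] for the induction on [F]; the bound [n <= color v] added
     below keeps the head apart from the tail. *)
  move: {WF} 0 => n col.
  suff : uniq (pmap id F) && all (fun v => n <= color v) (pmap id F) by case/andP.
  elim: F n col => //= o F IH n col.
  have /andP[uF lF] : uniq (pmap id F) && all (fun v => n < color v) (pmap id F).
    by apply: IH => i v E; rewrite addSnnS; apply: (col i.+1).
  have lF' : all (fun v => n <= color v) (pmap id F).
    by apply: sub_all lF => v /ltnW.
  case: o col => [v|] col /=; last by rewrite uF.
  rewrite uF lF' (col 0 v) // addn0 leqnn !andbT.
  by apply/negP => /(allP lF); rewrite (col 0 v) // addn0 ltnn.
- by move=> v; rewrite !inE.
Qed.

Lemma in_complex_down F v F' :
  in_complex (F ++ Some v :: F') -> in_complex (F ++ None :: F').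
Proof.
move=> WF; have col := in_complex_nth WF.
case/andP: WF => _ WF; apply/andP; split; last first.
  apply: sD WF; apply/fsubsetP => u; rewrite !inE !mem_pmap !map_id !mem_cat !inE.
  by case/orP=> [->|/= ->] //; rewrite !orbT.
apply/forallP => -[i iF] /=; case E: (nth _ _ i) => [u|] //.
by apply/eqP/col; move: E; rewrite !nth_cat; case: ltnP => // _; case: (i - _).
Qed.

Lemma color_cycle_supp x : size x = e.+1 -> color_cycle x != 0%R ->
  in_complex (map some x).
Proof.
move=> sx; rewrite /color_cycle; case: (map color x =P iota 0 e.+1) => [col|];
  last by rewrite eqxx.
move=> nz; apply/andP; split.
  apply/forallP => -[i]; rewrite size_map => ix /=.
  case E: (nth _ _ i) => [v|] //; move: E; rewrite (nth_map v) // => -[<-].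
  by rewrite -(nth_map v 0) // col nth_iota // -sx.
have -> : face_of (map some x) = [fset u in x].
  by apply/fsetP => u; rewrite !inE mem_pmap map_id mem_map // => ? ? [].
have [|xD] := boolP ([fset u in x] \in card_faces D e.+1).
  by rewrite !inE => /andP[].
by rewrite cycle_row_out // scaler0 eqxx in nz.
Qed.

Lemma size_colored_faces_leq k :
  size (colored_faces (V : seq U) e.+1 k in_complex) <= #|` card_faces D k|.
Proof.
set s := colored_faces _ _ _ _.
have us : uniq (map face_of s).
  rewrite map_inj_in_uniq ?colored_faces_uniq ?fset_uniq // => F F' Fs Fs'.
  have [WF sF _ _] := colored_facesP Fs; have [WF' sF' _ _] := colored_facesP Fs'.
  by apply: (@in_complex_face_inj e.+1); rewrite ?inE /= ?WF ?WF' ?sF ?sF' eqxx.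
rewrite -(size_map face_of); apply: uniq_leq_size => // _ /mapP[F Fs ->].
have [WF _ cF _] := colored_facesP Fs.
by rewrite !inE card_face_of // cF eqxx andbT; case/andP: WF.
Qed.

Lemma min_faces_leq_card_faces k :
  min_faces e.+1 k (\rank (kermx (boundary K D e))) <= #|` card_faces D k|.
Proof.
apply: leq_trans (size_colored_faces_leq k).
apply: leq_trans (leq_min_faces _ _ rank_cycles_leq) _.
apply: min_faces_leq_colored_faces.
- exact: color_cycle_supp.
- by move=> F v F'; apply: in_complex_down.
- exact: color_cycleP.
Qed.

End TopCycles.

(** * Cliques of Turan graphs *)

Section CliqueEmbedding.

Variables (T T' : finType) (e : rel T) (e' : rel T') (f : T -> T').
Hypothesis f_inj : injective f.
Hypothesis f_rel : forall x y, e' (f x) (f y) = e x y.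

Lemma cliquesP (S : finType) (r : rel S) k (A : {set S}) :
  reflect (#|A| = k /\ {in A &, forall x y, x != y -> r x y})
    (A \in cliques r k).
Proof.
rewrite inE; apply: (iffP andP) => [[/eqP kA /forall_inP clA]|[kA clA]].
  by split=> // x y xA yA xy; move/forall_inP: (clA x xA) => /(_ y yA)/implyP;
    apply.
split; first exact/eqP.
apply/forall_inP => x xA; apply/forall_inP => y yA; apply/implyP; exact: clA.
Qed.

Lemma imset_cliques k (A : {set T}) : (f @: A \in cliques e' k) = (A \in
  cliques e k).
Proof.
apply/cliquesP/cliquesP; rewrite card_imset // => -[kA clA]; split=> // x y.
  by move=> xA yA xy; rewrite -f_rel clA ?imset_f // (inj_eq f_inj).
move=> /imsetP[x' xA ->] /imsetP[y' yA ->]; rewrite (inj_eq f_inj) f_rel.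
exact: clA.
Qed.

Lemma imset_preimset (B : {set T'}) : {subset B <= codom f} -> f @: (f @^-1: B) = B.
Proof.
move=> sB; apply/setP => y; apply/imsetP/idP => [[x + ->]|yB]; first by rewrite inE.
by have /codomP[x E] := sB y yB; exists x; rewrite // inE -E.
Qed.

Lemma card_cliques_sub k (Q : pred T') :
  (forall y, Q y = (y \in codom f)) ->
  #|[set B in cliques e' k | [forall y in B, Q y]]| = #|cliques e k|.
Proof.
move=> QE; rewrite -(card_imset _ (imset_inj f_inj)); apply: eq_card => B.
rewrite [LHS]inE; apply/andP/imsetP => [[clB /forall_inP sB]|[A clA ->]].
  have EB : f @: (f @^-1: B) = B.
    by apply: imset_preimset => y /sB; rewrite QE.
  by exists (f @^-1: B); rewrite // -imset_cliques EB.
rewrite imset_cliques; split=> //; apply/forall_inP => _ /imsetP[x _ ->].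
by rewrite QE codom_f.
Qed.

Variable z : T'.
Hypothesis z_codom : z \notin codom f.
Hypothesis z_rel : forall x, e' z (f x) && e' (f x) z.

Lemma add_vertex_inj : injective (fun A : {set T} => z |: f @: A).
Proof.
move=> A B /setP E; apply/setP => x; have := E (f x).
have fz : f x != z by apply: contraNneq z_codom => <-; apply: codom_f.
by rewrite !inE (negPf fz) /= !mem_imset.
Qed.

Lemma add_vertex_cliques k (A : {set T}) :
  (z |: f @: A \in cliques e' k.+1) = (A \in cliques e k).
Proof.
have zA : z \notin f @: A.
  by apply: contra z_codom => /imsetP[x _ ->]; apply: codom_f.
rewrite -imset_cliques; apply/cliquesP/cliquesP; rewrite cardsU1 zA add1n.
  by move=> [[kA] cl]; split=> // x y xA yA; apply: cl; rewrite inE ?xA ?yA orbT.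
move=> [-> cl]; split=> // x y; rewrite !inE.
case/predU1P=> [->|xA] /predU1P[->|yA]; rewrite ?eqxx //; last exact: cl.
  by case/imsetP: yA => y' _ ->; case/andP: (z_rel y').
by case/imsetP: xA => x' _ ->; case/andP: (z_rel x').
Qed.

Lemma add_vertex_onto k (Q : pred T') (B : {set T'}) :
  (forall y, e' z y -> Q y -> y != z -> y \in codom f) ->
  B \in cliques e' k.+1 -> z \in B -> {in B, forall y, Q y} ->
  exists2 A : {set T}, A \in cliques e k & B = z |: f @: A.
Proof.
move=> QE clB zB sB; have EB : f @: (f @^-1: (B :\ z)) = B :\ z.
  apply: imset_preimset => y; rewrite !inE => /andP[yz yB]; apply: QE => //.
    by have /cliquesP[_ cl] := clB; apply: cl; rewrite // eq_sym.
  exact: sB.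
exists (f @^-1: (B :\ z)); last by rewrite EB setD1K.
by rewrite -add_vertex_cliques EB setD1K.
Qed.

Lemma card_cliques_add_vertex k (Q : pred T') :
  (forall y, e' z y -> Q y -> y != z -> y \in codom f) -> Q z ->
  (forall x, Q (f x)) ->
  #|[set B in cliques e' k.+1 | (z \in B) && [forall y in B, Q y]]| = #|cliques
    e k|.
Proof.
move=> QE Qz Qf; rewrite -(card_imset _ add_vertex_inj); apply: eq_card => B.
rewrite [LHS]inE; apply/andP/imsetP => [[clB /andP[zB /forall_inP sB]]|[A clA ->]].
  exact: add_vertex_onto clB zB sB.
rewrite add_vertex_cliques; split=> //; rewrite setU11 /=.
by apply/forall_inP => y; rewrite !inE => /predU1P[-> //|/imsetP[x _ ->]].
Qed.

End CliqueEmbedding.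

Lemma modn_subl D n u v : u <= n -> v <= n ->
  (n - u == n - v %[mod D]) = (u == v %[mod D]).
Proof.
move=> un vn; rewrite -(eqn_modDr (u + v)) addnA subnK // [u + v]addnC addnA
  subnK //.
by rewrite eqn_modDl eq_sym.
Qed.

Section Relabel.

(* The vertices x < n of T_(d+1) in other parts than n form a copy of T_d. As
   the parts are counted from n downwards, so is the relabelling. *)
Variables (d n : nat).
Let p := n - n %/ d.+1.
Definition relabel x := n.-1 - (p.-1 - x + (p.-1 - x) %/ d).

(** For [0 < d] this enumerates the numbers not congruent to [d] modulo [d.+1]. Since [n.-1 - w]
    lies in the part of [n] exactly when [w] is congruent to [d], that part is what gets skipped. *)
Let up u := u + u %/ d.

Let leq_p : p <= n := leq_subr _ _.

Lemma relabel_lt x : x < p -> relabel x < n.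
Proof.
by move=> xp; rewrite /relabel -/(up _); move: (up _) leq_p xp => w; case: (n); lia.
Qed.

Hypothesis d_gt0 : 0 < d.

Lemma up_divn u : up u %/ d.+1 = u %/ d.
Proof.
rewrite /up {1}(divn_eq u d) addnAC -mulnSr divnMDl // [_ %% _ %/ _]divn_small
  ?addn0 //.
by rewrite ltnW // ltnS ltn_pmod.
Qed.

Lemma up_modn u : up u %% d.+1 = u %% d.
Proof.
by rewrite /up {1}(divn_eq u d) addnAC -mulnSr modnMDl modn_small // ltnW //
  ltnS ltn_pmod.
Qed.

Lemma ltn_up u : (up u < n) = (u < p).
Proof.
rewrite /p; have := divn_eq n d.+1; have := ltn_mod n d.+1.
have := divn_eq (up u) d.+1; rewrite up_divn up_modn.
have := divn_eq u d; have := ltn_mod u d; rewrite d_gt0.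
set a := u %/ d; set b := u %% d; set a' := n %/ d.+1; set b' := n %% d.+1.
move=> /= lb Eu Eup lb' En.
case: (ltngtP a a') => H; last by apply/idP/idP; nia.
  by have : a * d.+1 + d < n; [nia | move=> ?; apply/idP/idP; nia].
by have : n <= a * d.+1; [nia | move=> ?; apply/idP/idP; nia].
Qed.

Lemma up_homo u v : u < v -> up u < up v.
Proof. by move=> uv; rewrite /up; have := leq_div2r d (ltnW uv); lia. Qed.

Lemma relabel_homo x y : x < y -> y < p -> relabel x < relabel y.
Proof.
move=> xy yp; have := @up_homo (p.-1 - y) (p.-1 - x); rewrite /relabel -!/(up _).
have : up (p.-1 - x) < n by rewrite ltn_up; lia.
lia.
Qed.

Lemma relabel_part x y : x < p -> y < p ->
  (relabel x == relabel y %[mod d.+1]) = (x == y %[mod d]).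
Proof.
move=> xp yp; rewrite /relabel -!/(up _) modn_subl; first last.
- by have := ltn_up (p.-1 - y); lia.
- by have := ltn_up (p.-1 - x); lia.
by rewrite !up_modn modn_subl //; lia.
Qed.

Lemma relabel_neq x : x < p -> (relabel x != n %[mod d.+1]).
Proof.
move=> xp; rewrite /relabel -/(up _).
have lt1 : up (p.-1 - x) < n by rewrite ltn_up; lia.
rewrite -(eqn_modDr (up (p.-1 - x)).+1) (_ : _ - _ + _ = n + 0); last by lia.
rewrite eqn_modDl mod0n -addn1 -modnDml up_modn.
have := ltn_pmod (p.-1 - x) d_gt0.
set b := _ %% d => lb; rewrite modn_small; lia.
Qed.

Lemma relabel_onto y : y < n -> (y != n %[mod d.+1]) ->
  exists2 x, x < p & relabel x = y.
Proof.
move=> yn neq; pose w := n.-1 - y; pose u := w %/ d.+1 * d + w %% d.+1.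
have wd : w %% d.+1 < d.
  rewrite ltn_neqAle -ltnS ltn_mod andbT; apply: contra neq => /eqP E.
  rewrite -(eqn_modDr w.+1) (_ : y + _ = n + 0); last by rewrite /w; lia.
  by rewrite eqn_modDl mod0n -addn1 -modnDml E addn1 modnn.
have uw : up u = w.
  rewrite /up /u divnMDl // [_ %/ d in X in _ + X]divn_small // addn0.
  by rewrite [RHS](divn_eq w d.+1) mulnS; lia.
have up_ : u < p by rewrite -ltn_up uw /w; lia.
exists (p.-1 - u); first by lia.
by rewrite /relabel -/(up _) (_ : p.-1 - (_ - u) = u) ?uw /w; lia.
Qed.

Lemma relabel_expand x i : x + i < p -> relabel x + i <= relabel (x + i).
Proof.
elim: i => [|i IH]; rewrite ?addn0 // !addnS => xip.
apply: leq_ltn_trans (relabel_homo (ltnSn _) xip).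
exact/IH/ltnW.
Qed.

(* The vertices 0, ..., d represent all d + 1 parts, one of which is left out. *)
Lemma relabel_geq x : x < p -> d <= x -> d < relabel x.
Proof.
move=> xp dx; rewrite ltnNge; apply/negP => le1.
have rx : relabel 0 + x <= relabel x by apply: relabel_expand; rewrite add0n.
have yd : n %% d.+1 <= d by rewrite -ltnS ltn_mod.
(* A strictly increasing map with [relabel x <= d <= x] would fix every vertex up to [x], among them
   [y], which lies in the omitted part. *)
set y := n %% d.+1 in yd.
have yp : y < p by lia.
have r1 : relabel 0 + y <= relabel y by apply: relabel_expand; rewrite add0n.
have r2 : relabel y + (x - y) <= relabel x.
  by have := @relabel_expand y (x - y); rewrite subnKC; [apply | lia].
have := relabel_neq yp; rewrite (_ : relabel y = y); last by lia.
by rewrite modn_mod eqxx.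
Qed.

End Relabel.

Lemma card_turan_cliques_lt d n m k (nm : n <= m) :
  #|[set B in cliques (@turan_graph d m) k | [forall y in B, y < n]]| =
  #|cliques (@turan_graph d n) k|.
Proof.
apply: (card_cliques_sub (f := widen_ord nm)) => // [x y E|y].
  by apply: val_inj; have := congr1 val E.
apply/idP/codomP => [yn|[x ->]]; last exact: (ltn_ord x).
by exists (Ordinal yn); apply: val_inj.
Qed.

(** Translation by [d] preserves residues modulo [d]. *)
Lemma card_turan_cliques_range d n m k (nm : n <= m) :
  #|[set B in cliques (@turan_graph d m) k | [forall y in B, d <= y < n]]| =
  #|cliques (@turan_graph d (n - d)) k|.
Proof.
have lt (x : 'I_(n - d)) : x + d < m by have := ltn_ord x; lia.
apply: (card_cliques_sub (f := fun x => Ordinal (lt x))) => [x y E|x y|y].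
- by apply: val_inj; have /addIn := congr1 val E.
- by rewrite /turan_graph /= !modnDr.
apply/andP/codomP => [[dy yn]|[x ->]] /=.
  have yd : y - d < n - d by lia.
  by exists (Ordinal yd); apply: val_inj; rewrite /= subnK.
by have := ltn_ord x; split; lia.
Qed.

Definition relabel_ord d n m (nm : n < m) (x : 'I_(n - n %/ d.+1)) : 'I_m :=
  Ordinal (ltn_trans (relabel_lt (ltn_ord x)) nm).

Lemma relabel_ord_gt0 d n (x : 'I_(n - n %/ d.+1)) : 0 < d.
Proof. by case: d x => // -[x] /=; rewrite divn1 subnn. Qed.

Lemma relabel_ord_homo d n m (nm : n < m) (x y : 'I_(n - n %/ d.+1)) :
  (relabel_ord nm x < relabel_ord nm y) = (x < y).
Proof.
have d_gt0 := relabel_ord_gt0 x.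
have homo u v : u < v -> v < n - n %/ d.+1 -> relabel d n u < relabel d n v.
  exact: relabel_homo.
rewrite /=; case: (ltngtP x y) => [xy|yx|->]; last by rewrite ltnn.
  exact: homo.
by apply/negbTE; rewrite -leqNgt ltnW // homo.
Qed.

Lemma relabel_ord_inj d n m (nm : n < m) : injective (@relabel_ord d n m nm).
Proof.
move=> x y E; apply: val_inj; case: (ltngtP x y) => // H.
  by have := relabel_ord_homo nm x y; rewrite E ltnn H.
by have := relabel_ord_homo nm y x; rewrite E ltnn H.
Qed.

Lemma relabel_ord_rel d n m (nm : n < m) x y :
  @turan_graph d.+1 m (relabel_ord nm x) (relabel_ord nm y) =
  @turan_graph d (n - n %/ d.+1) x y.
Proof.
by rewrite /turan_graph /= relabel_part ?ltn_ord //; apply: relabel_ord_gt0 x.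
Qed.

Lemma relabel_ord_lt d n m (nm : n < m) (x : 'I_(n - n %/ d.+1)) :
  relabel_ord nm x < n.
Proof. exact/relabel_lt/ltn_ord. Qed.

Lemma relabel_ord_neq d n m (nm : n < m) (x : 'I_(n - n %/ d.+1)) :
  (val (relabel_ord nm x) != n %[mod d.+1]).
Proof. by apply: relabel_neq; rewrite ?(relabel_ord_gt0 x). Qed.

Lemma relabel_ord_codom d n m (nm : n < m) (y : 'I_m) :
  y < n -> (n != y %[mod d.+1]) -> y \in codom (@relabel_ord d n m nm).
Proof.
move=> yn neq; have d_gt0 : 0 < d by case: (d) neq => //; rewrite !modn1.
rewrite eq_sym in neq; have [x xp E] := relabel_onto d_gt0 yn neq.
by apply/codomP; exists (Ordinal xp); apply: val_inj.
Qed.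

Section TopVertex.
Variables (d n m : nat) (nm : n < m).
Let z := Ordinal nm.
Let f := @relabel_ord d n m nm.

Lemma top_vertex_codom : z \notin codom f.
Proof.
apply/codomP => -[x /(congr1 val) /= E].
by have := relabel_ord_lt nm x; rewrite /= -E ltnn.
Qed.

Lemma top_vertex_rel x :
  @turan_graph d.+1 m z (f x) && @turan_graph d.+1 m (f x) z.
Proof.
by rewrite /turan_graph eq_sym andbb /=; have := relabel_ord_neq nm x.
Qed.

Lemma top_vertex_nbr (y : 'I_m) :
  @turan_graph d.+1 m z y -> y <= n -> y != z -> y \in codom f.
Proof.
move=> zy yn yz; apply: relabel_ord_codom; last exact: zy.
by rewrite ltn_neqAle yn andbT; apply: contra yz => /eqP E; apply/eqP/val_inj.
Qed.

Lemma card_turan_cliques_top k :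
  #|[set B in cliques (@turan_graph d.+1 m) k.+1 |
      (z \in B) && [forall y in B, y <= n]]| =
  #|cliques (@turan_graph d (n - n %/ d.+1)) k|.
Proof.
apply: (@card_cliques_add_vertex _ _ _ _ f _ _ z _ _ k (fun y => y <= n)).
- exact: relabel_ord_inj.
- exact: relabel_ord_rel.
- exact: top_vertex_codom.
- exact: top_vertex_rel.
- exact: top_vertex_nbr.
- exact: leqnn.
- by move=> x; apply/ltnW/relabel_ord_lt.
Qed.
End TopVertex.

Lemma card_turan_cliquesS d n k :
  #|cliques (@turan_graph d.+1 n.+1) k.+1| =
  #|cliques (@turan_graph d.+1 n) k.+1| +
  #|cliques (@turan_graph d (n - n %/ d.+1)) k|.
Proof.
rewrite -(card_turan_cliques_lt _ _ (leqnSn n)) -(card_turan_cliques_top d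
  (ltnSn n)).
rewrite -(cardsID [set B : {set 'I_n.+1} | Ordinal (ltnSn n) \in B]) addnC.
congr (_ + _); apply: eq_card => B; rewrite !inE.
  rewrite andbC; apply: andb_id2l => _; apply/negP/forall_inP => [zB y yB|ltB zB].
    rewrite ltn_neqAle -ltnS ltn_ord andbT; apply/negP => /eqP E.
    by case: zB; rewrite (_ : Ordinal _ = y) //; apply: val_inj.
  by have := ltB _ zB; rewrite /= ltnn.
apply: andb_id2l => _; rewrite andb_idr // => _.
by apply/forall_inP => y _; rewrite -ltnS.
Qed.

Lemma card_cliques0 (T : finType) (e : rel T) : #|cliques e 0| = 1.
Proof.
rewrite -(cards1 (set0 : {set T})); apply: eq_card => A; rewrite [RHS]inE.
apply/cliquesP/eqP => [[/eqP]|->]; first by rewrite cards_eq0 => /eqP.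
by rewrite cards0; split=> // x; rewrite inE.
Qed.

(* For d = 0 the congruence modulo 0 makes turan_graph 0 n complete, hence the
   restriction. *)
Lemma card_turan_cliques d n k : (0 < d) || (n == 0) ->
  #|cliques (@turan_graph d n) k| = turan d n k.
Proof.
elim: d n k => [|d IH] n k.
  move=> /= /eqP->; case: k => [|k]; first exact: card_cliques0.
  apply/eqP; rewrite cards_eq0; apply/eqP/setP => A; rewrite [RHS]inE.
  apply/cliquesP => -[kA _]; have := subset_leqif_cards (subsetT A).
  by rewrite kA cardsT card_ord => -[].
case: k => [|k] _; first by rewrite card_cliques0 turan_k0.
elim: n => [|n IHn].
  rewrite /= big_ord0; apply/eqP; rewrite cards_eq0; apply/eqP/setP => A.
  rewrite [RHS]inE; apply/cliquesP => -[kA _].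
  by have := subset_leqif_cards (subsetT A); rewrite kA cardsT card_ord => -[].
rewrite card_turan_cliquesS turanS IHn IH //.
by case: (d) => //=; rewrite divn1 subnn.
Qed.

Lemma turan_binomE (n k : nat) d : 0 < d -> turan_binom n k d = turan d n k.
Proof. by move=> d_gt0; apply: card_turan_cliques; rewrite d_gt0. Qed.

Lemma turan_binom_sub (n : nat) d : 0 < d ->
  turan_binom (n%:Z - d%:Z)%R d d = turan d (n - d) d.
Proof.
move=> d_gt0; have [dn|nd] := leqP d n; first by rewrite subzn // turan_binomE.
rewrite (_ : n - d = 0) ?turan_small //; last by lia.
by case E: (n%:Z - d%:Z)%R => [a|a] //; lia.
Qed.

(** * Canonical representations *)

Lemma turan_bin d n k : n <= d -> turan d n k = 'C(n, k).
Proof.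
elim: d n k => [|d IH] n [|k]; rewrite ?turan_k0 ?bin0 //.
  by rewrite leqn0 => /eqP->.
elim: n => [|n IHn] nd; first by rewrite /= big_ord0.
by rewrite turanS IHn ?(ltnW nd) // divn_small // subn0 IH // binS.
Qed.

Lemma turan_addS d r k : r <= d ->
  turan d.+1 (d.+1 + r).+1 k.+1 = turan d.+1 (d.+1 + r) k.+1 + turan d (d + r) k.
Proof.
move=> rd; rewrite turanS; congr (_ + turan _ _ _).
by rewrite divnDl ?divnn // divn_small // addn0 addSn subn1.
Qed.

(** As [r <= d], some part of T_(d+1)(d+1+r) is a single vertex, joined to all others; deleting it
    leaves T_d(d+r). *)
Lemma turan_peel d r k : r <= d ->
  turan d.+1 (d.+1 + r) k.+1 = turan d (d + r) k.+1 + turan d (d + r) k.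
Proof.
elim: r d k => [|r IH] d k rd; first by rewrite !addn0 !turan_bin // binS.
case: d rd => // d rd; rewrite !addnS turan_addS ?(ltnW rd) // IH ?(ltnW rd) //.
rewrite turan_addS // -!addnA; congr (_ + _).
case: k => [|k]; first by rewrite !turan_k0.
by rewrite turan_addS // (IH d k) //; lia.
Qed.

Lemma turan_double d k : turan d (d + d) k = 'C(d, k) * 2 ^ k.
Proof.
elim: d k => [|d IH] [|k] //.
rewrite [in X in turan _ X _]addnS turan_addS // turan_peel // !IH binS expnS; ring.
Qed.

(** A completed level corresponds to the clique complex of T_d(2d+j): deleting one vertex from each
    part leaves T_d(d+j), whose [d]-cliques number [layer_size d j]. *)
Lemma min_faces_layer_size d j k :
  min_faces d k (layer_size d j) = turan d (d + d + j) k.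
Proof.
elim: d j k => [|d IH] j k; first by rewrite min_faces_dim0 muln1; case: k.
elim: j => [|j IHj].
  by rewrite addn0 layer_sizeE_filled /filled big_ord0 min_faces1 turan_double.
rewrite layer_sizeS min_facesD // IHj (addnS _ j).
case: k IHj => [|k] _; first by rewrite !turan_k0 addn0.
rewrite (turanS d (d.+1 + d.+1 + j) k) /link_faces /shift_faces IH;
  congr (_ + turan _ _ _).
have -> : (d.+1 + d.+1 + j) %/ d.+1 = 2 + j %/ d.+1.
  by rewrite addnn -mul2n divnMDl.
by have := leq_div j d.+1; lia.
Qed.

Lemma min_faces_turan d n k x : d <= n -> 0 < x ->
  x <= turan d (n - n %/ d.+1) d ->
  min_faces d.+1 k (turan d.+1 n d.+1 + x) =
  turan d.+1 (n + d.+1) k + link_faces d k x.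
Proof.
move=> dn x_gt0 lex; case: (ltnP d n) => [ltdn|]; last first.
  (* For [n = d] no level is complete and only [x = 1] is possible; the cross-polytope then arises
     from T_(d+1)(2d+1) by adding its last vertex. *)
  move=> nd; have En : n = d by lia.
  move: lex; rewrite En divn_small // subn0 turan_bin // binn (turan_small
    (ltnSn d)).
  move=> lex; have -> : x = 1 by lia.
  rewrite min_faces1 -turan_double [in LHS]addnS; case: k => [|k].
    by rewrite !turan_k0.
  by rewrite turan_addS // (addnC d d.+1) /link_faces /shift_faces min_faces1
    turan_double.
have [j Ej] : exists j, n = d.+1 + j by exists (n - d.+1); lia.
have capE : turan d (n - n %/ d.+1) d = layer_cap d j.
  rewrite /layer_cap layer_sizeE Ej; congr turan.
  by rewrite divnDl ?divnn //; have := leq_div j d.+1; lia.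
by rewrite {1}Ej -layer_sizeE min_facesD -?capE // min_faces_layer_size Ej addnAC.
Qed.

Lemma divn_sub1 D m : (m - D) %/ D = m %/ D - 1.
Proof. by rewrite -{1}[D]mul1n divnBMl. Qed.

(** Subtracting [d.+1] from [m] lowers the quotient by one, so both sides of the canonical condition
    drop by [d]; [d + d < m] keeps the right side positive if the left one is truncated to 0. *)
Lemma shifted_index_lt d m m' : 0 < d -> d + d < m -> m' < m - m %/ d.+1 ->
  m' - d < m - d.+1 - (m - d.+1) %/ d.+1.
Proof.
move=> d_gt0 dm; rewrite divn_sub1.
have := subn_divn_homo d (_ : d.+1 + d <= m); rewrite divnDl ?divnn //.
rewrite divn_small // => /(_ dm); have := @divn_gt0 d.+1 m isT.
by move: (m %/ _) => q; lia.
Qed.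

Section Canonical.

Variable M : nat -> nat.

Definition canonical_chain d s := forall i, i < s ->
  M (d - i.+1) < M (d - i) - M (d - i) %/ (d - i).

Definition turan_sum d k s := \sum_(i < s.+1) turan (d - i) (M (d - i)) (k - i).

Definition shifted_turan_sum d s :=
  \sum_(i < s.+1) turan (d - i) (M (d - i) - (d - i)) (d - i).

Lemma canonical_chainS d s : canonical_chain d.+1 s.+1 ->
  M d < M d.+1 - M d.+1 %/ d.+1 /\ canonical_chain d s.
Proof.
move=> ch; split; first by have := ch 0 isT; rewrite subn0 subSS subn0.
by move=> i si; have := ch i.+1 si; rewrite !subSS.
Qed.

Lemma turan_sum0 d k : turan_sum d k 0 = turan d (M d) k.
Proof. by rewrite /turan_sum big_ord1 !subn0. Qed.

Lemma turan_sumS d k s :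
  turan_sum d.+1 k.+1 s.+1 = turan d.+1 (M d.+1) k.+1 + turan_sum d k s.
Proof. by rewrite /turan_sum big_ord_recl !subn0. Qed.

Lemma shifted_turan_sum0 d : shifted_turan_sum d 0 = turan d (M d - d) d.
Proof. by rewrite /shifted_turan_sum big_ord1 !subn0. Qed.

Lemma shifted_turan_sumS d s : shifted_turan_sum d.+1 s.+1 =
  turan d.+1 (M d.+1 - d.+1) d.+1 + shifted_turan_sum d s.
Proof. by rewrite /shifted_turan_sum big_ord_recl !subn0. Qed.

Lemma turan_sum_leq d k s : s < k <= d -> canonical_chain d s ->
  turan_sum d k s <= turan d (M d).+1 k.
Proof.
elim: s d k => [|s IH] [|d] [|k] //;
  rewrite ?ltn0 ?andbF // ?turan_sum0 => /andP[sk kd] ch.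
  exact: leq_turan.
have [lt1 ch'] := canonical_chainS ch.
rewrite turan_sumS turanS leq_add2l; apply: leq_trans (IH d k _ ch') _;
  first by lia.
exact: leq_turan.
Qed.

Lemma turan_sum_lt d k s : s < k <= d -> canonical_chain d s ->
  k - s <= M (d - s) -> turan_sum d k s < turan d (M d).+1 k.
Proof.
elim: s d k => [|s IH] [|d] [|k] //;
  rewrite ?ltn0 ?andbF // ?turan_sum0 => /andP[sk kd] ch.
  rewrite !subn0 => kM; rewrite turanS -[X in X < _]addn0 ltn_add2l turan_gt0 //.
  apply: leq_trans (subn_divn_homo d (_ : k <= M d.+1)); last by lia.
  by rewrite divn_small ?subn0.
rewrite !subSS => kM; have [lt1 ch'] := canonical_chainS ch.
rewrite turan_sumS turanS ltn_add2l; apply: leq_trans (IH d k _ ch' kM) _;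
  first by lia.
exact: leq_turan.
Qed.

Lemma shifted_turan_sum_eq0 d s : s < d -> canonical_chain d s ->
  (M d).+1 < d + d -> shifted_turan_sum d s = 0.
Proof.
elim: s d => [|s IH] [|d] // sd ch lt2.
  by rewrite shifted_turan_sum0 turan_small; lia.
have [lt1 ch'] := canonical_chainS ch.
rewrite shifted_turan_sumS turan_small; last by lia.
rewrite IH //; have := @divn_gt0 d.+1 (M d.+1) isT.
by move: (_ %/ _) lt1 => q lt1; case: (leqP d.+1 (M d.+1)); lia.
Qed.

Lemma shifted_turan_sum_lt d s n : s < d -> canonical_chain d s ->
  d <= n -> M d - d < n -> shifted_turan_sum d s < turan d n d.
Proof.
elim: s d n => [|s IH] [|d] n // sd ch dn Mn;
  have [lt2|ge2] := ltnP (M d.+1).+1 (d.+1 + d.+1).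
- by rewrite shifted_turan_sum_eq0 // turan_gt0.
- rewrite shifted_turan_sum0; apply: leq_trans (leq_turan _ _ Mn).
  rewrite turanS -[X in X < _]addn0 ltn_add2l turan_gt0 //.
  apply: leq_trans (subn_divn_homo d (_ : d <= _)); last by lia.
  by rewrite divn_small ?subn0.
- by rewrite shifted_turan_sum_eq0 // turan_gt0.
have [lt1 ch'] := canonical_chainS ch.
rewrite shifted_turan_sumS; apply: leq_trans (leq_turan _ _ Mn).
rewrite turanS ltn_add2l; apply: IH => //.
  apply: leq_trans (subn_divn_homo d (_ : d <= _)); last by lia.
  by rewrite divn_small ?subn0.
by apply: shifted_index_lt => //; lia.
Qed.

(** One cycle more than the bound would force too many faces. The leading shifted term is a
    completed level and, by [shifted_turan_sum_lt], the rest stays in the next layer, where the link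
    costs allow induction. *)
Lemma min_faces_canonical d k s : s < k <= d -> canonical_chain d s ->
  k - s <= M (d - s) ->
  turan_sum d k s < min_faces d k (shifted_turan_sum d s).+1.
Proof.
elim: s d k => [|s IH] [|d] [|k] //; rewrite ?ltn0 ?andbF // => /andP[sk kd] ch kM;
  have [lt2|ge2] := ltnP (M d.+1).+1 (d.+1 + d.+1).
(* In this range the shifted sum is 0, and the faces are too few for a single cross-polytope. *)
- rewrite shifted_turan_sum_eq0 // min_faces1 -turan_double.
  by apply: leq_trans (turan_sum_lt _ ch kM) (leq_turan _ _ (ltnW lt2)).
- have dM : d <= M d.+1 - d.+1 by lia.
  have cap_gt0 : 0 < turan d (M d.+1 - d.+1 - (M d.+1 - d.+1) %/ d.+1) d.
    apply: turan_gt0 => //; apply: leq_trans (subn_divn_homo d dM).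
    by rewrite divn_small ?subn0.
  rewrite shifted_turan_sum0 turan_sum0 -[X in min_faces _ _ X]addn1.
  rewrite min_faces_turan // subnK; last by lia.
  rewrite -[X in X < _]addn0 ltn_add2l /link_faces /shift_faces min_faces1.
  by rewrite muln_gt0 bin_gt0 expn_gt0 -ltnS kd.
- rewrite shifted_turan_sum_eq0 //; last by lia.
  rewrite min_faces1 -turan_double.
  by apply: leq_trans (turan_sum_lt _ ch kM) (leq_turan _ _ (ltnW lt2)); rewrite sk.
have [lt1 ch'] := canonical_chainS ch.
have dM : d <= M d.+1 - d.+1 by lia.
have lt_cap : shifted_turan_sum d s <
    turan d (M d.+1 - d.+1 - (M d.+1 - d.+1) %/ d.+1) d.
  apply: shifted_turan_sum_lt => //; first by lia.
    by apply: leq_trans (subn_divn_homo d dM); rewrite divn_small ?subn0.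
  by apply: shifted_index_lt => //; lia.
rewrite shifted_turan_sumS turan_sumS -[X in min_faces _ _ X]addnS
  min_faces_turan // subnK; last by lia.
by rewrite ltn_add2l; apply: IH => //; rewrite -ltnS sk.
Qed.

End Canonical.

(** * Revlex initial segments *)

Definition ord_revlex_gt p (A B : {set 'I_p}) : bool :=
  [exists x in A :\: B, [forall y in B :\: A, y < x]].

Lemma ord_revlex_gtP p (A B : {set 'I_p}) :
  reflect (exists2 x, x \in A :\: B & {in B :\: A, forall y : 'I_p, y < x})
          (ord_revlex_gt A B).
Proof.
by apply: (iffP exists_inP) => -[x xA /forall_inP lt]; exists x.
Qed.

Lemma ord_revlex_total p (A B : {set 'I_p}) :
  A != B -> ord_revlex_gt A B || ord_revlex_gt B A.
Proof.
move=> nAB; pose S := (A :\: B) :|: (B :\: A).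
have [x0 Sx0] : exists x, x \in S.
  apply/set0Pn; apply: contraNneq nAB => S0; apply/eqP/setP => x.
  by have /setP/(_ x) := S0; rewrite !inE; case: (x \in A); case: (x \in B).
have [x Sx maxx] := @arg_maxnP _ x0 (mem S) val Sx0.
have lt y : y \in S -> y != x -> y < x.
  by move=> Sy yx; rewrite ltn_neqAle -(inj_eq val_inj) in yx *; rewrite yx;
    apply: maxx.
have [xS|xS] := setUP Sx; apply/orP; [left|right]; apply/ord_revlex_gtP;
  exists x => // y yS; (apply: lt; first by rewrite /S in_setU yS ?orbT);
  by apply/eqP => E; move: yS xS; rewrite E !inE => /andP[/negPf->] _;
    rewrite andbF.
Qed.

Definition revlex_initial d p (X : {set {set 'I_p}}) :=
  X \subset cliques (@turan_graph d p) d /\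
  (forall A B, A \in X -> B \in cliques (@turan_graph d p) d ->
     ord_revlex_gt A B -> B \in X).

(** If a clique [A] below [n] were missing, every member of [X] would precede [A] and so lie below
    [n] too; but there are too few such cliques other than [A]. *)
Lemma revlex_initial_lt d n p (X : {set {set 'I_p}}) : 0 < d -> n <= p ->
  revlex_initial d X -> turan d n d <= #|X| ->
  [set B in cliques (@turan_graph d p) d | [forall y in B, y < n]] \subset X.
Proof.
move=> d_gt0 np [sX downX]; rewrite -card_turan_cliques ?d_gt0 //.
rewrite -(card_turan_cliques_lt _ _ np); set L := [set B in _ | _] => leLX.
apply/subsetP => A AL; apply/negPn/negP => nAX.
have := AL; rewrite inE => /andP[clA /forall_inP ltA].
suff /subset_leq_card : X \subset L :\ A.
  by move=> le1; have := leq_trans leLX le1; rewrite (cardsD1 A L) AL ltnn.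
apply/subsetP => B BX; have nBA : B != A by apply: contraNneq nAX => <-.
have /ord_revlex_gtP[x] : ord_revlex_gt A B.
  by case/orP: (ord_revlex_total nBA) => // gtBA; case/negP: nAX; apply: downX gtBA.
rewrite inE => /andP[_ xA] ltx; rewrite in_setD1 nBA inE (subsetP sX) //=.
apply/forall_inP => y yB; have [yA|nyA] := boolP (y \in A); first exact: ltA.
by apply: ltn_trans (ltA x xA); apply: ltx; rewrite inE nyA.
Qed.

Lemma revlex_initial_range d n p (X : {set {set 'I_p}}) : 0 < d -> n <= p ->
  revlex_initial d X -> turan d n d <= #|X| ->
  [set B in cliques (@turan_graph d p) d | [forall y in B, d <= y < n]] \subset
  [set A in X | [forall y in A, d <= y]].
Proof.
move=> d_gt0 np iniX leX; have sLX := revlex_initial_lt d_gt0 np iniX leX.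
apply/subsetP => A; rewrite inE => /andP[clA /forall_inP rA]; rewrite inE.
apply/andP; split; last by apply/forall_inP => y /rA/andP[].
by apply: (subsetP sLX); rewrite inE clA; apply/forall_inP => y /rA/andP[].
Qed.

Section RevlexCount.
Variable M : nat -> nat.

(** Induction on the terms: the leading one counts cliques below its upper entry [n], all of which
    lie in [X]. The cliques of [X] with largest vertex [n] become, after relabelling, an initial
    segment [X'] with one part fewer. *)
Lemma revlex_base_avoiding s d p (X : {set {set 'I_p}}) :
  s < d -> canonical_chain M d s -> M d < p -> revlex_initial d X ->
  turan_sum M d d s <= #|X| ->
  shifted_turan_sum M d s <= #|[set A in X | [forall y in A, d <= y]]|.
Proof.
elim: s d p X => [|s IH] [|d] p X // sd ch Mp iniX leX.
  rewrite shifted_turan_sum0 -card_turan_cliques //.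
  rewrite -(card_turan_cliques_range _ _ (ltnW Mp)).
  by apply/subset_leq_card/revlex_initial_range; rewrite // -?turan_sum0 // ltnW.
have [lt2|ge2] := ltnP (M d.+1).+1 (d.+1 + d.+1).
  by rewrite shifted_turan_sum_eq0.
have leX1 : turan d.+1 (M d.+1) d.+1 <= #|X| by move: leX; rewrite turan_sumS; lia.
pose R := [set B in cliques (@turan_graph d.+1 p) d.+1 |
  [forall y in B, d < y < M d.+1]].
have cardR : #|R| = turan d.+1 (M d.+1 - d.+1) d.+1.
  by rewrite card_turan_cliques_range ?card_turan_cliques // ltnW.
have sRX := revlex_initial_range (ltn0Sn d) (ltnW Mp) iniX leX1.
case: iniX => sX downX.
set n := M d.+1 in Mp ge2 R leX1 cardR sRX.
pose C := cliques (@turan_graph d.+1 p) d.+1.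
pose L := [set B in C | [forall y in B, y < n]].
have cardL : #|L| = turan d.+1 n d.+1.
  by rewrite card_turan_cliques_lt ?card_turan_cliques // ltnW.
have [lt1 ch'] := canonical_chainS ch.
pose z := Ordinal Mp; pose f := @relabel_ord d n p Mp.
pose g (A : {set 'I_(n - n %/ d.+1)}) : {set 'I_p} := z |: f @: A.
have g_inj : injective g by apply: add_vertex_inj;
  [exact: relabel_ord_inj | exact: top_vertex_codom].
have g_clique A : (g A \in C) = (A \in cliques (@turan_graph d (n - n %/ d.+1)) d).
  apply: add_vertex_cliques;
    [exact: relabel_ord_inj | exact: relabel_ord_rel | exact: top_vertex_codom
      | exact: top_vertex_rel].
have fz x : f x != z by apply: contraNneq (top_vertex_codom d Mp) => E;
  rewrite -[Ordinal Mp]/z -E codom_f.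
have mem_g x A : (f x \in g A) = (x \in A).
  by rewrite !inE (negPf (fz x)) mem_imset //; apply: relabel_ord_inj.
pose X' := [set A | g A \in X].
have sX' : X' \subset cliques (@turan_graph d (n - n %/ d.+1)) d.
  by apply/subsetP => A; rewrite inE => /(subsetP sX); rewrite -g_clique.
have downX' A B : A \in X' -> B \in cliques (@turan_graph d (n - n %/ d.+1)) d ->
    ord_revlex_gt A B -> B \in X'.
  rewrite inE => AX clB /ord_revlex_gtP[x xAB ltx]; rewrite inE.
  apply: downX AX _ _; first by rewrite -/C g_clique.
  apply/ord_revlex_gtP; exists (f x); first by rewrite inE !mem_g -in_setD.
  move=> y; rewrite inE => /andP[nyA /setU1P[yz|/imsetP[y' y'B Ey]]].
    by case/negP: nyA; rewrite yz setU11.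
  move: nyA; rewrite Ey mem_g => nyA; rewrite relabel_ord_homo; apply: ltx.
  by rewrite inE nyA.
have g_le A y : y \in g A -> y <= n.
  by case/setU1P => [->|/imsetP[x _ ->]] //; apply/ltnW/relabel_ord_lt.
have leX' : turan_sum M d d s <= #|X'|.
  (* If a clique of [X] has a vertex above [n], all cliques with largest vertex [n] precede it and
     [X'] contains every top clique. Otherwise [L] and the image of [X'] cover [X]. *)
  have [/exists_inP[B BX /exists_inP[x xB ltx]]|] :=
      boolP [exists B in X, [exists x in B, n < x]].
    apply: leq_trans (turan_sum_leq _ ch') _; first by lia.
    apply: (@leq_trans (turan d (n - n %/ d.+1) d)); first exact: leq_turan.
    rewrite -card_turan_cliques; last by case: (d) => //=; rewrite divn1 subnn.
    apply/subset_leq_card/subsetP => A clA; rewrite inE.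
    apply: downX BX _ _; first by rewrite -/C g_clique.
    apply/ord_revlex_gtP; exists x.
      by rewrite inE xB andbT; apply/negP => /g_le; lia.
    by move=> y; rewrite inE => /andP[_ /g_le]; lia.
  rewrite negb_exists_in => /forall_inP noB.
  have : X \subset L :|: (g @: X').
    apply/subsetP => B BX; have clB : B \in C by apply: (subsetP sX).
    have leB y : y \in B -> y <= n.
      have := noB B BX; rewrite negb_exists_in => /forall_inP h /h.
      by rewrite -leqNgt.
    rewrite inE; have [zB|nzB] := boolP (z \in B).
      have [A clA EB] := add_vertex_onto (@relabel_ord_inj d n p Mp)
        (@relabel_ord_rel d n p Mp)
         (top_vertex_codom d Mp) (top_vertex_rel Mp) (@top_vertex_nbr d n p Mp)
           clB zB leB.
      by apply/orP; right; apply/imsetP; exists A => //; rewrite inE /g -EB.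
    apply/orP; left; rewrite inE clB; apply/forall_inP => y yB.
    rewrite ltn_neqAle leB // andbT; apply: contra nzB => /eqP E.
    by rewrite (_ : z = y) //; apply: val_inj.
  move/subset_leq_card; rewrite cardsU card_imset // cardL.
  by move: leX; rewrite turan_sumS -/n; lia.
have := IH d _ X' sd ch' lt1 (conj sX' downX') leX'.
set Y := [set A in X' | _] => leY.
have disj : R :&: g @: Y = set0.
  apply/setP => B; rewrite !inE; apply/negP.
  case/andP=> /andP[_ /forall_inP ltB] /imsetP[A _ EB].
  by have := ltB z; rewrite EB setU11 /= ltnn andbF => /(_ isT).
rewrite shifted_turan_sumS -cardR; apply: leq_trans (leq_add (leqnn _) leY) _.
rewrite -(card_imset (mem Y) g_inj) -cardsUI disj cards0 addn0.
apply/subset_leq_card; rewrite subUset sRX /=.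
apply/subsetP => _ /imsetP[A + ->]; rewrite inE => /andP[AX /forall_inP geA].
rewrite inE; apply/andP; split; first by move: AX; rewrite inE.
apply/forall_inP => y /setU1P[->|/imsetP[x xA ->]] /=; first by lia.
by apply: relabel_geq => //; [exact: relabel_ord_gt0 x | exact: geA].
Qed.

End RevlexCount.

(** * Cross-polytopes *)

Section CrossPolytopes.

Variables (K : fieldType) (U : countType) (e : nat) (color : U -> nat).
Variable (D : {fset {fset U}}) (base : nat -> U).
Hypothesis color_lt : forall u, color u < e.+1.
Hypothesis color_inj : forall A, A \in D -> {in A &, injective color}.
Hypothesis color_base : forall i, i < e.+1 -> color (base i) = i.

Definition over_base (A B : {fset U}) :=
  [forall v : B, (val v \in A) || (val v == base (color (val v)))].

Definition avoids_base (A : {fset U}) := [forall v : A, val v != base (color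
  (val v))].

Definition base_avoiding := [fset A in card_faces D e.+1 | avoids_base A].

Hypothesis cross_polytope : forall A B, A \in base_avoiding ->
  #|` B| = e.+1 -> {in B &, injective color} -> over_base A B -> B \in D.

Definition base_count (B : {fset U}) := \sum_(v <- B) (v == base (color v)).

(** The fundamental cycle of the cross-polytope on [A] and the base vertices; the last sign changes
    when a vertex of [A] is exchanged for the base vertex of its colour. *)
Definition cross_cycle (A B : {fset U}) : K :=
  if (B \in card_faces D e.+1) && over_base A B then
    (face_sign K color B * (-1) ^+ base_count B)%R else 0%R.

Lemma over_baseP A B :
  reflect {in B, forall v, (v \in A) || (v == base (color v))} (over_base A B).
Proof.
apply: (iffP forallP) => [H v vB|H v]; first exact: (H [` vB]).
by apply: H; apply: valP.
Qed.

Lemma avoids_baseP A :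
  reflect {in A, forall v, v != base (color v)} (avoids_base A).
Proof.
apply: (iffP forallP) => [H v vA|H v]; first exact: (H [` vA]).
by apply: H; apply: valP.
Qed.

Lemma color_onto A i : A \in card_faces D e.+1 -> i < e.+1 ->
  exists2 v, v \in A & color v = i.
Proof.
move=> AD ie; have [x [colx <-]] := colored_enumeration color_lt color_inj AD.
have : i \in map color x by rewrite colx mem_iota.
by case/mapP => v vx ->; exists v; rewrite ?inE.
Qed.

(** A ridge [a] over [A] misses one colour [i] and lies in exactly two facets of the cross-polytope,
    by adding the vertex [u] of [A] or [base i]; their terms cancel. Any other ridge lies in
    none. *)
Lemma cross_cycle_sum A (a : {fset U}) : A \in base_avoiding ->
  a \in card_faces D e ->
  (\sum_(B <- card_faces D e.+1) incidence K B a *: (cross_cycle A B : K^o) = 0)%R.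
Proof.
move=> AA aD.
have w0 B : B \notin card_faces D e.+1 -> (cross_cycle A B : K^o) = 0%R.
  by rewrite /cross_cycle => /negPf->.
have [s _ ->] := incidence_sum_sign color_lt color_inj aD w0.
set S := (X in (s *: X)%R); suff -> : S = 0%R by rewrite scaler0.
have [/over_baseP oa|noa] := boolP (over_base A a); last first.
  rewrite /S big1 // => v va; rewrite /cross_cycle.
  case: ifP; rewrite ?scaler0 // => /andP[_ /over_baseP ov].
  by case/negP: noa; apply/over_baseP => u ua; apply: ov; rewrite !inE ua orbT.
have := aD; rewrite !inE => /andP[aD' /eqP sa].
have := AA; rewrite !inE => /andP[/andP[AD /eqP sA] /avoids_baseP avA].
have AF : A \in card_faces D e.+1 by rewrite !inE AD sA eqxx.
have [i ie nia] : exists2 i, i < e.+1 & i \notin map color a.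
  have : ~~ all (mem (map color a)) (iota 0 e.+1).
    apply/negP => /allP /(uniq_leq_size (iota_uniq _ _)).
    by rewrite size_iota size_map sa ltnn.
  by case/allPn => i; rewrite mem_iota; exists i.
have [u uA colu] := color_onto AF ie.
have term v : color v = i -> (v \in A) || (v == base (color v)) ->
    (v \notin a) * (v |` a \in card_faces D e.+1) * over_base A (v |` a).
  move=> colv vAb; have va : v \notin a.
    by apply: contra nia => va; rewrite -colv map_f.
  have ov : over_base A (v |` a).
    by apply/over_baseP => y; rewrite !inE => /predU1P[-> //|]; apply: oa.
  have cva : #|` v |` a| = e.+1 by rewrite cardfsU1 va sa.
  do !split=> //; rewrite !inE cva eqxx andbT; apply: (cross_polytope AA) => //.
  have nv y : y \in a -> color y != color v.
    by move=> ya; apply: contra nia => /eqP Ey; rewrite -colv -Ey map_f.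
  move=> y y'; rewrite !inE => /predU1P[->|ya] /predU1P[->|y'a] //.
  - by move/esym/eqP; rewrite (negPf (nv _ y'a)).
  - by move/eqP; rewrite (negPf (nv _ ya)).
  - exact: (color_inj aD').
have nub : u != base i by rewrite -colu; apply: avA.
have colb := color_base ie.
have [[ua uF] uo] := term u colu (introT orP (or_introl uA)).
have [[ba bF] bo] : (base i \notin a) * (base i |` a \in card_faces D e.+1) *
  over_base A (base i |` a).
  by apply: term; rewrite ?colb ?eqxx ?orbT.
have val_term v : v \notin a -> v |` a \in card_faces D e.+1 -> over_base A (v
  |` a) ->
   (face_sign K color (v |` a) *: (cross_cycle A (v |` a) : K^o) =
    (-1) ^+ (v == base (color v)) * (-1) ^+ base_count a)%R.
  move=> va vF vo; rewrite /cross_cycle vF vo /= /GRing.scale /= mulrA -expr2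
    sqrr_sign mul1r.
  by rewrite /base_count big_fsetU1 //= exprD.
have uV : u \in \bigcup_(B <- D) B by apply: mem_vertices AD uA.
have bV : base i \in \bigcup_(B <- D) B.
  by apply: (@mem_vertices _ _ (base i |` a)); rewrite ?fset1U1 //; move: bF;
    rewrite !inE => /andP[].
rewrite /S big_mkcond (big_fsetD1 u) //= (big_fsetD1 (base i)) /=; last first.
  by rewrite !inE eq_sym nub.
rewrite ua ba !val_term // colu colb eqxx (negPf nub) big1_seq ?addr0.
  by rewrite expr0 expr1 mulN1r mul1r subrr.
move=> v /= /fsetD1P[vb /fsetD1P[vu _]]; case: ifP => // va.
rewrite /cross_cycle; case: ifP; rewrite ?scaler0 // => /andP[vF /over_baseP ov].
have vD : v |` a \in D by move: vF; rewrite !inE => /andP[].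
have colv : color v = i.
  apply/eqP/negPn/negP => ncol.
  have sub : {subset i :: map color (v |` a) <= iota 0 e.+1}.
    move=> c; rewrite inE => /predU1P[->|/mapP[y _ ->]]; rewrite mem_iota //=.
  have : uniq (i :: map color (v |` a)).
    rewrite /= map_inj_in_uniq ?fset_uniq ?andbT; last exact: (color_inj vD).
    apply/mapP => -[y]; rewrite !inE => /predU1P[->|ya] E.
      by rewrite E eqxx in ncol.
    by case/negP: nia; rewrite E map_f.
  move/uniq_leq_size => /(_ _ sub) /=; rewrite size_map size_iota cardfsU1 va sa.
  by rewrite ltnn.
have := ov v (fset1U1 _ _); rewrite colv (negPf vb) orbF => vA.
by case/eqP: vu; apply: (color_inj AD) => //; rewrite colv.
Qed.

(** A base-avoiding facet over [A] is [A] itself. Hence the cycles, read at these facets, form a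
    diagonal matrix with entries 1 or -1, which [S] inverts, so they are independent. *)
Lemma card_base_avoiding_leq :
  #|` base_avoiding| <= \rank (kermx (boundary K D e)).
Proof.
pose Z : 'M[K]_(#|{: base_avoiding}|, #|{: card_faces D e.+1}|) :=
  (\matrix_(i, j) cross_cycle (val (enum_val i)) (val (enum_val j)))%R.
have kerZ : (Z <= kermx (boundary K D e))%MS.
  apply/sub_kermxP/matrixP => i j; rewrite !mxE.
  rewrite -[RHS](cross_cycle_sum (valP (enum_val i)) (valP (enum_val j))).
  rewrite big_seq_fsetE (reindex enum_rank) /=; last first.
    by exists enum_val => ? _; rewrite ?enum_rankK ?enum_valK.
  by apply: eq_bigr => B _; rewrite !mxE !enum_rankK mulrC.
pose S : 'M[K]_(#|{: card_faces D e.+1}|, #|{: base_avoiding}|) :=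
  (\matrix_(j, i) if val (enum_val j) == val (enum_val i) :> {fset U} then
     cross_cycle (val (enum_val i)) (val (enum_val i)) else 0)%R.
have ZS : (Z *m S = 1%:M)%R.
  apply/matrixP => i i'; rewrite !mxE.
  have A'F : val (enum_val i') \in card_faces D e.+1.
    by have := valP (enum_val i'); rewrite inE => /andP[].
  rewrite (bigD1 (enum_rank [` A'F])) //= !mxE enum_rankK eqxx big1 ?addr0;
    last first.
    move=> j nj; rewrite !mxE; case: eqP => [E|]; rewrite ?mulr0 //.
    case/eqP: nj; rewrite -[LHS]enum_valK; congr enum_rank; exact: val_inj.
  have [->|nii] := eqVneq i i'.
    rewrite /cross_cycle A'F (_ : over_base _ _) /=.
      by rewrite -expr2 exprMn !sqrr_sign mulr1.
    by apply/over_baseP => v ->.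
  rewrite /cross_cycle; case: ifP => [/andP[_ /over_baseP ov]|];
    last by rewrite mul0r.
  case/eqP: nii; apply: enum_val_inj; apply: val_inj.
  have := valP (enum_val i');
    rewrite !inE => /andP[/andP[_ /eqP s'] /avoids_baseP av'].
  have := valP (enum_val i); rewrite !inE => /andP[/andP[_ /eqP s_] _].
  apply/esym/eqP; rewrite eqEfcard s' s_ leqnn andbT.
  by apply/fsubsetP => v vA; have := ov v vA; rewrite (negPf (av' v vA)) orbF.
rewrite cardfE; apply: leq_trans (mxrankS kerZ).
by rewrite -{1}(mxrank1 K #|{: base_avoiding}|) -ZS mxrankM_maxl.
Qed.

End CrossPolytopes.

(** * Colours from ordered partitions *)

Section Coloring.

Variables (U : countType) (d : nat) (P : 'I_d -> pred U).

Definition block_index (u : U) : nat := if [pick i | P i u] is Some i then val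
  i else 0.

Hypothesis partP : ordered_partition P.

Lemma block_indexP u : exists2 i : 'I_d, P i u & block_index u = i.
Proof.
have [i [Pi _]] := partP u; rewrite /block_index; case: pickP => [j Pj|/(_ i)].
  by exists j.
by rewrite Pi.
Qed.

Lemma block_indexE u (i : 'I_d) : P i u -> block_index u = i.
Proof.
move=> Pi; have [j Pj ->] := block_indexP u; have [k [_ uk]] := partP u.
by rewrite -(uk i Pi) -(uk j Pj).
Qed.

Lemma ltn_block_index u : block_index u < d.
Proof. by have [i _ ->] := block_indexP u. Qed.

Lemma partial_transversalP (A : {fset U}) :
  partial_transversal P A <-> {in A &, injective block_index}.
Proof.
split=> [trA x y xA yA E|inj i].
  have [i Pi Ei] := block_indexP x; have [j Pj Ej] := block_indexP y.
  have Eij : i = j by apply: val_inj; rewrite /= -Ei -Ej.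
  apply/eqP/negPn/negP => nxy; have := trA i.
  suff /fsubset_leq_card : [fset x; y] `<=` [fset z in A | P i z].
    by rewrite cardfs2 nxy => le1 le2; have := leq_trans le1 le2.
  apply/fsubsetP => z; rewrite !inE => /orP[]/eqP->; rewrite ?xA ?Pi //.
  by rewrite yA Eij Pj.
rewrite leqNgt; apply/negP => gt1.
have [x xB] : exists x, x \in [fset x in A | P i x].
  by apply/fset0Pn; rewrite -cardfs_gt0; apply: ltnW.
have : [fset x in A | P i x] `<=` [fset x].
  apply/fsubsetP => y; move: xB; rewrite !inE => /andP[xA Px] /andP[yA Py].
  by apply/eqP/inj => //; rewrite !(@block_indexE _ i).
by move/fsubset_leq_card; rewrite cardfs1 leqNgt gt1.
Qed.

End Coloring.

Lemma rank_reduced_homology_top (K : fieldType) (U : countType) (D : {fset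
  {fset U}}) e :
  card_faces D e.+2 = fset0 -> betti K D e = \rank (kermx (boundary K D e)).
Proof.
move=> D0; rewrite /betti /reduced_homology.
rewrite -[RHS](mxrank_cap_compl _ (boundary K D e.+1)).
suff -> : \rank (kermx (boundary K D e) :&: boundary K D e.+1)%MS = 0 by [].
apply/eqP; rewrite -leqn0; apply: leq_trans (mxrankS (capmxSr _ _)) _.
by apply: leq_trans (rank_leq_row _) _; rewrite -cardfE D0 cardfs0.
Qed.

Lemma betti_leq_rank (K : fieldType) (U : countType) (D : {fset {fset U}}) e :
  betti K D e <= \rank (kermx (boundary K D e)).
Proof. exact/mxrankS/diffmxSl. Qed.

(** * Positive integers as vertices of Turan graphs *)

Section Posint.

Variables (e p : nat).
Let d := e.+1.

(** The shift by one puts [posint_of n] into block [n %% d], in agreement with the parts of the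
    Turan graph. *)
Definition posint_of (n : nat) : posint := exist (fun m => 0 < m) n.+1 isT.

Lemma posint_ofK (m : posint) : posint_of (val m).-1 = m.
Proof. by apply: val_inj; rewrite /= prednK //; apply: (valP m). Qed.

Lemma Pi_partE (i : 'I_d) (m : posint) : Pi_part i m = ((val m).-1 %% d == i).
Proof.
rewrite /Pi_part -{1}(prednK (valP m)) -addn1 -[in X in _ == X](addn1 i) eqn_modDr.
by rewrite [i %% d]modn_small.
Qed.

Lemma Pi_partition : ordered_partition (@Pi_part d).
Proof.
move=> m; have lt : (val m).-1 %% d < d by rewrite ltn_mod.
exists (Ordinal lt); split; first by rewrite Pi_partE.
by move=> j; rewrite Pi_partE => /eqP E; apply: val_inj.
Qed.

Lemma Pi_index (m : posint) : block_index (@Pi_part d) m = (val m).-1 %% d.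
Proof.
have [i + ->] := block_indexP Pi_partition m; by rewrite Pi_partE => /eqP.
Qed.

Definition posint_set (A : {set 'I_p}) : {fset posint} :=
  [fset posint_of (val x) | x in A].

Lemma posint_of_inj : injective (fun x : 'I_p => posint_of (val x)).
Proof. by move=> x y /(congr1 val) [] /val_inj. Qed.

Lemma mem_posint_set (A : {set 'I_p}) x : (posint_of (val x) \in posint_set A)
  = (x \in A).
Proof.
apply/imfsetP/idP => [[y yA /posint_of_inj ->] //|xA]; by exists x.
Qed.

Lemma posint_set_inj : injective posint_set.
Proof. by move=> A B E; apply/setP => x; rewrite -!mem_posint_set E. Qed.

Lemma card_posint_set A : #|` posint_set A| = #|A|.
Proof. by rewrite card_imfset ?cardE //; apply: posint_of_inj. Qed.

Lemma card_posint_sets (Y : {set {set 'I_p}}) :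
  #|` [fset posint_set A | A in Y]| = #|Y|.
Proof. by rewrite card_imfset ?cardE //; apply: posint_set_inj. Qed.

Lemma posint_set_onto (F : {fset posint}) : {in F, forall m, val m <= p} ->
  posint_set [set x : 'I_p | posint_of (val x) \in F] = F.
Proof.
move=> leF; apply/fsetP => m; apply/imfsetP/idP => [[x + ->]|mF].
  by rewrite inE.
have lt : (val m).-1 < p by rewrite prednK ?leF //; apply: (valP m).
by exists (Ordinal lt); rewrite ?inE /= posint_ofK.
Qed.

Lemma transversal_clique (A : {set 'I_p}) :
  (A \in cliques (@turan_graph d p) d) <-> Pi_subset d d (posint_set A).
Proof.
rewrite /Pi_subset card_posint_set (partial_transversalP Pi_partition).
split=> [/cliquesP[kA clA]|[kA inj]].
  split=> // m m' /imfsetP[x xA ->] /imfsetP[y yA ->]; rewrite !Pi_index /= => E.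
  congr posint_of; congr val; apply/eqP/negPn/negP => nxy.
  by have := clA x y xA yA nxy; rewrite /turan_graph E eqxx.
apply/cliquesP; split=> // x y xA yA nxy; rewrite /turan_graph.
apply: contra nxy => /eqP E; apply/eqP/posint_of_inj/inj.
- by rewrite mem_posint_set.
- by rewrite mem_posint_set.
by rewrite !Pi_index.
Qed.

Lemma fset_max_leq (A : {fset posint}) n :
  (fset_max A <= n) = all (fun m => val m <= n) A.
Proof. by rewrite /fset_max; apply/bigmax_leqP_seq/allP => H m mA => [|_];
  apply: H. Qed.

Lemma leq_fset_max (A : {fset posint}) m : m \in A -> val m <= fset_max A.
Proof. by move=> mA; rewrite /fset_max (@leq_bigmax_seq _ _ _ val). Qed.

Lemma revlex_gt_posint_set (A B : {set 'I_p}) :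
  ord_revlex_gt A B -> revlex_gt (posint_set A) (posint_set B).
Proof.
case/ord_revlex_gtP => x; rewrite inE => /andP[xB xA] ltx; rewrite /revlex_gt.
apply: (@leq_trans (val (posint_of x))); last first.
  by apply: leq_fset_max; rewrite inE !mem_posint_set xB.
rewrite /= ltnS fset_max_leq; apply/allP => m;
  rewrite inE => /andP[+ /imfsetP[y /= yB Em]].
rewrite Em mem_posint_set => nyA; apply: ltx; by rewrite inE nyA.
Qed.

End Posint.

(** * The upper bound and the equality case *)

Lemma ge0_of_subn_divz_gt0 (x : int) (D : nat) : (0 < D)%N ->
  (0 < x - (x %/ D)%Z)%R -> (0 <= x)%R.
Proof.
move=> D_gt0; have D_neq0 : (D%:Z != 0)%R by lia.
have := modz_ge0 x D_neq0; have := @ltz_pmod x D%:Z D_gt0; have := divz_eq x D.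
set q := (x %/ D)%Z; set r := (x %% D)%Z => Ex ltr ger.
have [q_ge0|q_lt0] := leP 0%R q; nia.
Qed.

(** Nonnegativity climbs from the last entry, which is at least [k - s], to the first: an entry
    minus its quotient exceeds the next entry, which forces it to be nonnegative. *)
Lemma canonical_representation_nat N k d s (M : nat -> int) : k <= d ->
  canonical_representation N k d s M ->
  let m i := `|M i|%N in
  [/\ forall i, i <= s -> M (d - i)%N = (m (d - i)%N)%:Z,
      s < k, canonical_chain m d s, k - s <= m (d - s) & N = turan_sum m d k s].
Proof.
move=> kd [EN chM leM sk] m.
have M_ge0 j : j <= s -> (0 <= M (d - (s - j))%N)%R.
  elim: j => [|j IH] js; first by rewrite subn0; apply: le_trans leM; lia.
  have lt_s : s - j.+1 < s by lia.
  have := chM _ lt_s; rewrite (_ : (s - j.+1).+1 = s - j)%N => [lt1|]; last by lia.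
  apply: (@ge0_of_subn_divz_gt0 _ (d - (s - j.+1))%N); first by lia.
  exact: le_lt_trans (IH (ltnW js)) lt1.
have ME i : i <= s -> M (d - i)%N = (m (d - i)%N)%:Z.
  by move=> si; have := M_ge0 (s - i)%N (leq_subr _ _); rewrite subKn // /m; lia.
split=> //.
- move=> i si; have := chM i si; rewrite (ME i.+1) // (ME i (ltnW si)) divz_nat.
  by have := leq_div (m (d - i)%N) (d - i)%N; lia.
- by move: leM; rewrite ME.
rewrite EN; apply: eq_bigr => -[i /= si] _.
rewrite (ME i si) turan_binomE //; lia.
Qed.

Lemma betti_leq_shifted_turan_sum (K : fieldType) (U : countType)
    (D : {fset {fset U}}) k e s m :
  s < k <= e.+1 -> canonical_chain m e.+1 s -> k - s <= m (e.+1 - s) ->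
  balanced_class k e.+1 (turan_sum m e.+1 k s) D ->
  betti K D e <= shifted_turan_sum m e.+1 s.
Proof.
move=> sk ch leM [[[P [[_ sD] partP trP]] _]]; rewrite /f_num prednK => [fD|];
  last by lia.
have inj A : A \in D -> {in A &, injective (block_index P)}.
  by move=> AD; apply/partial_transversalP => //; apply: trP.
have := min_faces_leq_card_faces K sD (ltn_block_index partP) inj k.
rewrite fD leqNgt [betti _ _ _ <= _]leqNgt; apply: contra => lt1.
apply: leq_trans (min_faces_canonical sk ch leM) (leq_min_faces _ _ _).
exact: leq_trans lt1 (betti_leq_rank _ _ _).
Qed.

Lemma shifted_turan_sum_leq_betti (K : fieldType) (D : {fset {fset posint}}) e s m :
  s < e.+1 -> canonical_chain m e.+1 s ->
  dimension D = (e.+1%:Z - 1)%R -> revlex e.+1 D ->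
  f_num D e = turan_sum m e.+1 e.+1 s ->
  shifted_turan_sum m e.+1 s <= betti K D e.
Proof.
move=> se ch; rewrite /dimension => dimD [[[Dn0 sD] partP trD] revD] fD.
have D0 : card_faces D e.+2 = fset0.
  apply/fsetP => A; rewrite !inE; apply/negP => /andP[AD /eqP sA].
  have := @leq_bigmax_seq _ (enum_fset D) xpredT (fun A : {fset posint} => #|`
    A|) A AD isT.
  by case: (addIr _ dimD) => ->; rewrite sA ltnn.
rewrite rank_reduced_homology_top //.
pose color := block_index (@Pi_part e.+1).
have inj A : A \in D -> {in A &, injective color}.
  by move=> AD; apply/partial_transversalP => //; apply: trD.
have color_base i : i < e.+1 -> color (posint_of i) = i.
  by move=> ie; rewrite /color Pi_index /= modn_small.
have baseE v : (v == posint_of (color v)) = (val v <= e.+1).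
  rewrite -val_eqE /= /color Pi_index; have := valP v; rewrite /=.
  move: (val v) => [|n] //= _; rewrite eqSS; apply/eqP/idP => [->|le1].
    by rewrite ltn_mod.
  by rewrite modn_small.
have PiD (A : {fset posint}) : #|` A| = e.+1 -> {in A &, injective color} ->
  Pi_subset e.+1 e.+1 A.
  by move=> sA iA; split=> //; apply/partial_transversalP.
(* The base vertices are the integers up to [e.+1]. So vertices of [B] outside [A] are at most
   [e.+1] and those of [A] outside [B] are larger: [B] precedes [A]. *)
have cross (A B : {fset posint}) : A \in base_avoiding e color D posint_of ->
    #|` B| = e.+1 -> {in B &, injective color} -> over_base color posint_of A B
      -> B \in D.
  rewrite !inE => /andP[/andP[AD /eqP sA] /avoids_baseP avA] sB iB /over_baseP ov.
  have [->//|nAB] := eqVneq B A.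
  apply: (revD e.+1 A B) => //; try by apply: PiD => //; apply: inj.
    by rewrite leqnn.
  have [x xAB] : exists x, x \in A `\` B.
    apply/fset0Pn; rewrite fsetD_eq0; apply: contra nAB => sAB.
    by rewrite eq_sym eqEfcard sAB sA sB /=.
  apply: (@leq_trans (val x)); last exact: leq_fset_max.
  have xe : e.+1 < val x.
    by move: xAB; rewrite inE => /andP[_ /avA]; rewrite baseE -ltnNge.
  apply: leq_trans xe; rewrite ltnS fset_max_leq; apply/allP => y.
  by rewrite inE => /andP[nyA /ov]; rewrite (negPf nyA) baseE.
apply: leq_trans (card_base_avoiding_leq K (ltn_block_index (@Pi_partition e))
  inj color_base cross).
(* A finite range containing all vertices of [D] and, as [revlex_base_avoiding] demands, exceeding
   [m e.+1]. *)
pose p := maxn (m e.+1).+1 (\max_(A <- D) fset_max A).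
have leDp A v : A \in D -> v \in A -> val v <= p.
  move=> AD vA; apply: leq_trans (leq_fset_max vA) _; rewrite leq_max;
    apply/orP; right.
  exact: (@leq_bigmax_seq _ (enum_fset D) xpredT fset_max).
pose X := [set A : {set 'I_p} | posint_set A \in card_faces D e.+1].
have iniX : revlex_initial e.+1 X.
  split=> [|A B].
    apply/subsetP => A; rewrite inE => AX; apply/transversal_clique.
    by move: AX; rewrite !inE => /andP[AD /eqP sA]; apply: PiD => //; apply: inj.
  rewrite inE => AX clB /revlex_gt_posint_set gtAB; rewrite inE.
  move: AX; rewrite inE /= => /andP[AD /eqP sA].
  have trB := (transversal_clique e B).1 clB.
  rewrite !inE; apply/andP; split; last by apply/eqP; case: trB.
  apply: (revD e.+1 (posint_set A)) => //; first by rewrite leqnn.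
  by apply: PiD => //; apply: inj.
have leX : turan_sum m e.+1 e.+1 s <= #|X|.
  rewrite -fD /f_num /= -card_posint_sets; apply/fsubset_leq_card/fsubsetP => F FD.
  have EF : posint_set [set x : 'I_p | posint_of (val x) \in F] = F.
    by apply: posint_set_onto => v; apply: leDp; move: FD; rewrite inE => /andP[].
  by rewrite -EF in_imfset //= inE EF.
have lt_p : m e.+1 < p by rewrite leq_max leqnn.
apply: leq_trans (revlex_base_avoiding se ch lt_p iniX leX) _.
rewrite -card_posint_sets; apply/fsubset_leq_card/fsubsetP => F.
case/imfsetP => A /=; rewrite inE => /andP[AX /forall_inP avA ->].
move: AX; rewrite !inE => ->; rewrite andTb.
apply/avoids_baseP => v /imfsetP[x /= xA ->]; rewrite baseE -ltnNge /= ltnS.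
exact: avA.
Qed.

Local Close Scope nat_scope.

Theorem theorem3p5 (K : fieldType) (k d N s : nat) (M : nat -> int)
    (hk : (1 <= k)%N) (hkd : (k <= d)%N) (hN : (0 < N)%N)
    (hM : canonical_representation N k d s M) :
  (forall (U : countType) (D : {fset {fset U}}),
     balanced_class k d N D ->
     (betti K D d.-1 <=
      \sum_(i < s.+1)
        turan_binom (M (d - i)%N - (d - i)%N%:Z) (d - i)%N (d - i))%N)
  /\
  (forall D : {fset {fset posint}},
     balanced_class k d N D ->
     revlex d D ->
     f_num D d.-1 =
       (\sum_(i < s.+1) turan_binom (M (d - i)%N) (d - i)%N (d - i))%N ->
     betti K D d.-1 =
       (\sum_(i < s.+1)
          turan_binom (M (d - i)%N - (d - i)%N%:Z) (d - i)%N (d - i))%N).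
Proof.
have [ME sk ch leM EN] := canonical_representation_nat hkd hM.
set m := fun i => `|M i|%N in ME ch leM EN.
have -> : (\sum_(i < s.+1) turan_binom (M (d - i)%N - (d - i)%N%:Z) (d - i)%N
  (d - i) =
    shifted_turan_sum m d s)%N.
  apply: eq_bigr => -[i /= si] _; rewrite (ME i si) turan_binom_sub //; lia.
have -> : (\sum_(i < s.+1) turan_binom (M (d - i)%N) (d - i)%N (d - i) =
    turan_sum m d d s)%N.
  apply: eq_bigr => -[i /= si] _; rewrite (ME i si) turan_binomE //; lia.
rewrite EN; case: d hkd => [|e] hkd in hM ME ch leM EN *; first by lia.
have sk' : (s < k <= e.+1)%N by rewrite sk.
split=> [U D|D DN revD fD]; first exact: betti_leq_shifted_turan_sum.
apply/eqP; rewrite eqn_leq (betti_leq_shifted_turan_sum K sk' ch leM DN).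
case: DN => -[_ dimD] _; apply: shifted_turan_sum_leq_betti fD => //.
exact: leq_trans sk hkd.
Qed.
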